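(* Let $g:[0,T]\times\mathbb{R}\to\mathbb{R}^+$ be such that, for each $t\in[0,T]$, $z\mapsto g(t,z)$ is convex, $g(t,0)=0$, and $$\limsup_{|z|\to\infty}\frac{g(t,z)}{|z|^2}=\infty.$$ Then there exists a bounded, $\mathcal{F}_T$-measurable, $\mathbb{R}$-valued process $\psi(\cdot)$ on $[0,T]$ such that the backward stochastic Volterra integral equation $$Y(t)=\psi(t)+\int_t^Tg(t,Z(t,s))\,ds-\int_t^TZ(t,s)\,dW(s),\quad t\in[0,T],$$ has no bounded solution.
   Context: $T>0$ is fixed; $(\Omega,\mathcal{F},\mathbb{F},\mathbb{P})$ is a filtered complete probability space carrying a standard one-dimensional Brownian motion $W(\cdot)$, and $\mathbb{F}=\{\mathcal{F}_t\}_{t\ge0}$ is its natural filtration augmented by all $\mathbb{P}$-null sets. $\mathbb{R}^+=[0,\infty)$. An $\mathcal{F}_T$-measurable process is a $\mathcal{B}[0,T]\otimes\mathcal{F}_T$-measurable map $[0,T]\times\Omega\to\mathbb{R}$ (not necessarily adapted). A bounded solution is a pair $(Y(\cdot),Z(\cdot,\cdot))$ taking values in $\mathbb{R}\times\mathbb{R}$, with $Y$ $\mathbb{F}$-adapted and $Z(t,\cdot)$ $\mathbb{F}$-progressively measurable on $[t,T]$, which satisfies the equation in the usual Itô sense for each $t\in[0,T]$ and is such that $Y(\cdot)$ is bounded and, for each $t\in[0,T]$, $\mathbb{E}\big[\int_t^Tg(t,Z(t,s))ds\big]<+\infty$.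
   Formalization: A bounded solution is additionally required to have Z(t,·) square integrable, E∫_t^T |Z(t,s)|² ds < ∞ for each t; with only a.s. finiteness of ∫|Z|² ds the claim fails, e.g. for g(t,z) = max(z,0)³ by Dudley's representation with Z ≤ 0. *)

(* Defs.v *)
From HB Require Import structures.
From mathcomp Require Import all_boot all_order all_algebra.
From mathcomp Require Import all_classical all_reals all_analysis.

Set Implicit Arguments.
Unset Strict Implicit.
Unset Printing Implicit Defensive.

Import Order.TTheory GRing.Theory Num.Theory.
Import numFieldNormedType.Exports.

Local Open Scope classical_set_scope.
Local Open Scope ring_scope.

(* Time is a real number throughout; a process [X : R -> Omega -> R] is only
   looked at on the time interval that the definition at hand mentions. *)

Section Processes.
Context (R : realType) d (Omega : measurableType d).
Implicit Types (F : R -> set_system Omega) (W X Y psi : R -> Omega -> R).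

Definition measurable_wrt (G : set_system Omega) (X : Omega -> R) :=
  measurable_fun [set: g_sigma_algebraType G] X.

(* measurability on [a, b] x Omega for the product of the Borel
   sigma-algebra and the sigma-algebra generated by G *)
Definition jointly_measurable_wrt (G : set_system Omega) (a b : R) X :=
  measurable_fun (`[a, b] `*` [set: g_sigma_algebraType G])
    (fun p : R * g_sigma_algebraType G => X p.1 p.2).

Definition adapted F (a b : R) X :=
  forall t : R, a <= t <= b -> measurable_wrt (F t) (X t).

Definition progressively_measurable F (a b : R) X :=
  forall t : R, a <= t <= b -> jointly_measurable_wrt (F t) a t X.

Variable P : probability Omega R.

Definition augmented_natural_filtration W (t : R) : set_system Omega :=
  <<s [set A | exists (s : R) (B : set R),
         [/\ 0 <= s, s <= t, measurable B & A = W s @^-1` B]]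
      `|` P.-negligible >>.

(* standard one-dimensional F-Brownian motion on [0, +oo[; the second
   argument of [normal_prob] is the mean, the third the standard deviation *)
Record brownian_motion F W : Prop := BrownianMotion {
  bm_measurable : forall t : R, 0 <= t -> measurable_fun setT (W t);
  bm_adapted : forall t : R, 0 <= t -> measurable_wrt (F t) (W t);
  bm_start : {ae P, forall w, W 0 w = 0};
  bm_continuous :
    {ae P, forall w, {within `[0, +oo[, continuous (W ^~ w)}};
  bm_normal : forall (s t : R) (B : set R), 0 <= s -> s < t -> measurable B ->
    P ((fun w => W t w - W s w) @^-1` B) = normal_prob 0 (Num.sqrt (t - s)) B;
  bm_independent : forall (s t : R) (A : set Omega) (B : set R),
    0 <= s -> s < t -> F s A -> measurable B ->
    P (A `&` (fun w => W t w - W s w) @^-1` B) =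
    (P A * P ((fun w => (W t w - W s w)%R) @^-1` B))%E }.

Record simple_process F (a b : R) := SimpleProcess {
  sp_size : nat;
  sp_time : nat -> R;
  sp_coef : nat -> Omega -> R;
  sp_first : sp_time 0 = a;
  sp_last : sp_time sp_size = b;
  sp_mono : forall i, (i < sp_size)%N -> sp_time i <= sp_time i.+1;
  sp_meas : forall i, (i < sp_size)%N ->
    measurable_wrt (F (sp_time i)) (sp_coef i);
  sp_bound : exists M : R, forall i w, (i < sp_size)%N -> `|sp_coef i w| <= M }.

Definition simple_eval F a b (H : simple_process F a b) (s : R) (w : Omega) : R :=
  \sum_(i < sp_size H)
    sp_coef H i w * \1_(`]sp_time H i, sp_time H i.+1]%classic) s.

Definition simple_integral F a b W (H : simple_process F a b) (w : Omega) : R :=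
  \sum_(i < sp_size H)
    sp_coef H i w * (W (sp_time H i.+1) w - W (sp_time H i) w).

Definition expected_square_norm (a b : R) X : \bar R :=
  (\int[P]_w \int[lebesgue_measure]_(s in `[a, b]) ((X s w) ^+ 2)%:E)%E.

(* I is (a version of) the Ito integral of Z over [a, b] against W, for a
   progressively measurable Z with E (int_a^b |Z(s)|^2 ds) < +oo: the L^2(P)-limit of
   the integrals of any simple processes converging to Z in L^2(ds x P).
   Such a sequence exists for every Z of this kind, and I does not depend on it
   up to a null set. *)
Definition is_ito_integral F W (a b : R) (Z : R -> Omega -> R)
    (I : Omega -> R) : Prop :=
  [/\ progressively_measurable F a b Z,
      (expected_square_norm a b Z < +oo)%E,
      measurable_fun setT I &
      exists H : nat -> simple_process F a b,
        ((fun n => expected_square_norm a b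
                     (fun s w => simple_eval (H n) s w - Z s w))
           @ \oo --> 0%E) /\
        ((fun n => (\int[P]_w ((simple_integral W (H n) w - I w) ^+ 2)%:E)%E)
           @ \oo --> 0%E)].

(* Bounded solutions (Y, Z) on [0, T] of
     Y(t) = psi(t) + int_t^T g(t,Z(t,s)) ds - int_t^T Z(t,s) dW(s).
   Z(t, .) is required to be square integrable on [t, T] x Omega, which is
   contained in [is_ito_integral]. If only int_t^T |Z(t,s)|^2 ds < +oo a.s. were
   asked for, then whenever g(t, .) vanishes on a half-line, as the other
   assumptions on g permit, Dudley's representation of F_T-measurable random
   variables by (one-signed) integrands would solve the equation with Y(t) = 0
   for t < T and Y(T) = psi(T), for every bounded psi. *)
Definition bounded_solution W (T : R) (g : R -> R -> R) psi
    Y (Z : R -> R -> Omega -> R) : Prop :=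
  let F := augmented_natural_filtration W in
  [/\ adapted F 0 T Y,
      forall t : R, 0 <= t <= T -> progressively_measurable F t T (Z t),
      exists M : R, forall t : R, 0 <= t <= T -> {ae P, forall w, `|Y t w| <= M},
      forall t : R, 0 <= t <= T ->
        (\int[P]_w \int[lebesgue_measure]_(s in `[t, T])
            (g t (Z t s w))%:E < +oo)%E &
      forall t : R, 0 <= t <= T ->
        exists2 I : Omega -> R, is_ito_integral F W t T (Z t) I &
          {ae P, forall w, Y t w = psi t w
             + \int[lebesgue_measure]_(s in `[t, T]) g t (Z t s w) - I w}].

End Processes.

(* the filter |z| -> +oo on R *)
Definition norm_infty_nbhs (R : realType) : set_system R :=
  [set A | exists M : R, forall z : R, M < `|z| -> A z].
Arguments norm_infty_nbhs R : clear implicits.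

(* Main.v *)
Require Import Defs.
From HB Require Import structures.
From mathcomp Require Import all_boot all_order all_algebra.
From mathcomp Require Import all_classical all_reals all_analysis.
From mathcomp Require Import measurable_realfun.
From mathcomp Require Import ring lra.

Set Implicit Arguments.
Unset Strict Implicit.
Unset Printing Implicit Defensive.

Import Order.TTheory GRing.Theory Num.Theory.
Import numFieldNormedType.Exports.

Local Open Scope classical_set_scope.
Local Open Scope ring_scope.

(* Only the time t = 0 matters. Put D = exp (q (W_T - W_a) - q^2 (T - a) / 2), the
   density of the law under which W acquires the drift q on [a, T]. Multiplying
   the equation by D, taking expectations, and subtracting the expectation of the
   equation itself gives, if q z - g(0, z) <= kappa for all z,
     E[D psi] - E[psi] <= E[int_a^T g(0, Z(0, s)) ds] + kappa (T - a).
   Since g(0, .) is superquadratic, a drift of size c / sqrt (T - a), which is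
   felt on the natural scale of W on [a, T], has a cost kappa (T - a) that is as
   small as we please when T - a is suitably small. Choose a_n -> T
   accordingly, and let psi(0) be the indicator of the union of events A_n on
   which W_T - W_{a_n} is exceptionally large in the direction of the drift q_n.
   The P(A_n) add up to at most 1/2, but the n-th drift makes A_n almost certain,
   so the left-hand side stays above 1/4 while the right-hand side tends to 0. *)

(** * Gaussian integrals and the moment generating function *)

Section Gaussian.
Context {R : realType}.
Local Notation mu := (@lebesgue_measure R).
Implicit Types (m s q x : R).

(** The Radon-Nikodym derivative of the normal law and [normal_pdf] have the same integral over
    every measurable set, so they agree almost everywhere; the claim is then the change of variables
    for the derivative. *)
Lemma ge0_integral_normal_prob m s (f : R -> \bar R) :
  measurable_fun [set: R] f -> (forall x, (0 <= f x)%E) ->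
  (\int[normal_prob m s]_x f x = \int[mu]_x (f x * (normal_pdf m s x)%:E))%E.
Proof.
move=> mf f0.
pose nu : {finite_measure set (measurableTypeR R) -> \bar R} := normal_prob m s.
have dom : nu `<< mu := normal_prob_dominates m s.
rewrite -(@Radon_Nikodym_SigmaFinite.change_of_variables _ _ _ nu mu)//.
pose h := Radon_Nikodym_SigmaFinite.f nu mu.
have mh : mu.-integrable setT h by exact: Radon_Nikodym_SigmaFinite.f_integrable.
have mpdf : measurable_fun setT (fun x => (normal_pdf m s x)%:E).
  by apply/measurable_EFinP; exact: measurable_normal_pdf.
have hE : ae_eq mu setT h (fun x => (normal_pdf m s x)%:E).
  apply: integral_ae_eq => //.
  by move=> E _ mE; rewrite -Radon_Nikodym_SigmaFinite.f_integral.
apply: ae_eq_integral => //.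
- by apply: emeasurable_funM => //; exact: measurable_int mh.
- exact: emeasurable_funM.
- by case: hE => N [mN N0 hN]; exists N; split => // x /= nfx; apply: hN => /= hx;
    apply: nfx => _; rewrite -(hx I).
Qed.

(** Completing the square: an exponential weight shifts the mean, which reduces the moment
    generating function to the total mass of a shifted Gaussian. *)
Lemma normal_pdf_tilt s q x : s != 0 ->
  expR (q * x) * normal_pdf 0 s x =
  expR (q ^+ 2 * s ^+ 2 / 2) * normal_pdf (q * s ^+ 2) s x.
Proof.
move=> s0; rewrite !normal_pdfE//= /normal_fun mulrCA [RHS]mulrCA; congr (_ * _).
by rewrite -!expRD; congr expR; field.
Qed.

Lemma normal_mgf s q : s != 0 ->
  (\int[normal_prob 0 s]_x (expR (q * x))%:E = (expR (q ^+ 2 * s ^+ 2 / 2))%:E)%E.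
Proof.
move=> s0; rewrite ge0_integral_normal_prob//; last first.
  by apply/measurable_EFinP; apply: measurableT_comp => //; exact: measurable_funM.
under eq_integral => x _.
  rewrite -EFinM normal_pdf_tilt//.
  rewrite EFinM; over.
by rewrite integralZl ?integral_normal_pdf ?mule1//; exact: integrable_normal_pdf.
Qed.

Lemma integrable_normal_expR s q : s != 0 ->
  (normal_prob 0 s).-integrable setT (fun x => (expR (q * x))%:E).
Proof.
move=> s0; apply/integrableP; split.
  by apply/measurable_EFinP; apply: measurableT_comp => //; exact: measurable_funM.
by under eq_integral do rewrite /= ger0_norm ?expR_ge0//; rewrite normal_mgf// ltry.
Qed.

(** Convexity of the exponential, [expR u >= 1 + u] at [u = (p - q) * x]; integrated over [x], it
    becomes a subgradient inequality in [p]. *)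
Lemma expR_tangent_le q (p : R) x :
  (p - q) * (x * expR (q * x)) <= expR (p * x) - expR (q * x).
Proof.
have -> : p * x = q * x + (p - q) * x by ring.
rewrite expRD; have := expR_ge1Dx ((p - q) * x); have := expR_gt0 (q * x).
by nra.
Qed.

Lemma normr_le_cosh x : `|x| <= expR x + expR (- x).
Proof.
have := expR_ge1Dx x; have := expR_ge1Dx (- x).
have := expR_gt0 x; have := expR_gt0 (- x).
by rewrite ler_norml; lra.
Qed.

(** Bounding [|x|] by [expR x + expR (- x)] trades the factor [x] for shifts of [q] by one in both
    directions. *)
Lemma integrable_normal_idexpR s q : s != 0 ->
  (normal_prob 0 s).-integrable setT (fun x => (x * expR (q * x))%:E).
Proof.
move=> s0; apply: le_integrable (integrableD _
  (integrable_normal_expR (q + 1) s0) (integrable_normal_expR (q - 1) s0)) => //.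
  apply/measurable_EFinP; apply: measurable_funM => //.
  by apply: measurableT_comp => //; exact: measurable_funM.
move=> x _ /=; rewrite lee_fin normrM [leRHS]ger0_norm ?addr_ge0 ?expR_ge0//.
rewrite (ger0_norm (expR_ge0 _)) !mulrDl !expRD mul1r mulN1r -mulrDr mulrC.
by rewrite ler_wpM2l ?expR_ge0// normr_le_cosh.
Qed.

(* [E (V e^(qV))] is a subgradient at [q] of the moment generating function,
   hence its derivative. *)
Lemma normal_mgf_derive s q : s != 0 ->
  \int[normal_prob 0 s]_x (x * expR (q * x)) =
  q * s ^+ 2 * expR (q ^+ 2 * s ^+ 2 / 2).
Proof.
move=> s0; set M := Rintegral _ _ _.
pose mg (p : R) := expR (p ^+ 2 * s ^+ 2 / 2).
have mgE p : \int[normal_prob 0 s]_x expR (p * x) = mg p.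
  by rewrite /Rintegral normal_mgf.
have sub p : (p - q) * M <= mg p - mg q.
  rewrite -!mgE /M -RintegralZl//; last exact: integrable_normal_idexpR.
  rewrite -RintegralB//; try exact: integrable_normal_expR.
  apply: le_Rintegral => //.
  - exact: (integrableZl measurableT (p - q) (integrable_normal_idexpR q s0)).
  - exact: (integrableB measurableT (integrable_normal_expR p s0)
                                    (integrable_normal_expR q s0)).
  by move=> x _; exact: expR_tangent_le.
(* The subgradient inequality makes [q] a minimum of [f], so the derivative read off the closed form
   [mg] vanishes there; no differentiation under the integral sign is involved. *)
pose f := fun p : R => mg p - p * M.
have df p : is_derive p (1 : R) f (p * s ^+ 2 * mg p - M).
  rewrite /f /mg; apply: is_derive_eq.
  by rewrite /GRing.scale/=; field.
have fq p : f q <= f p by rewrite /f; have := sub p; lra.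
have : is_derive q (1 : R) f 0.
  apply: (@derive1_at_min _ f (q - 1) (q + 1)) => //.
  - by lra.
  - by rewrite in_itv/=; lra.
by move=> [_ H0]; have [_ H1] := df q; move: H0; rewrite H1 /mg; lra.
Qed.

End Gaussian.

(** * Measurability with respect to a generated sigma-algebra *)

Section SubSigmaAlgebra.
Context {R : realType} d (Omega : measurableType d).
Implicit Types (G : set_system Omega) (X : Omega -> R).

Lemma measurable_wrt_sub G1 G2 X : <<s G1>> `<=` <<s G2>> ->
  measurable_wrt G1 X -> measurable_wrt G2 X.
Proof. by move=> G12 mX _ B mB; apply: G12; exact: mX. Qed.

Lemma measurable_wrt_measurable G X : <<s G>> `<=` measurable ->
  measurable_wrt G X -> measurable_fun [set: Omega] X.
Proof. by move=> GO mX _ B mB; apply: GO; exact: mX. Qed.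

Lemma measurable_wrtM G X1 X2 : measurable_wrt G X1 -> measurable_wrt G X2 ->
  measurable_wrt G (fun w => X1 w * X2 w).
Proof. exact: measurable_funM. Qed.

Lemma measurable_wrtB G X1 X2 : measurable_wrt G X1 -> measurable_wrt G X2 ->
  measurable_wrt G (fun w => X1 w - X2 w).
Proof. exact: measurable_funB. Qed.

Lemma measurable_wrt_comp G X (f : R -> R) : measurable_fun [set: R] f ->
  measurable_wrt G X -> measurable_wrt G (fun w => f (X w)).
Proof. by move=> mf mX; exact: (measurableT_comp mf mX). Qed.

End SubSigmaAlgebra.

(** * Expectation of a product of independent variables *)

Section Independence.
Context {R : realType} d (Omega : measurableType d) (P : probability Omega R).
Variables (G : set_system Omega) (X V : Omega -> R).
Hypothesis GO : <<s G>> `<=` measurable.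
Hypothesis mX : measurable_wrt G X.
Hypothesis mV : measurable_fun [set: Omega] V.
Hypothesis XV : forall (A : set Omega) (B : set R), <<s G>> A -> measurable B ->
  P (A `&` V @^-1` B) = (P A * P (V @^-1` B))%E.

Let mX' : measurable_fun [set: Omega] X.
Proof. exact: measurable_wrt_measurable mX. Qed.

Let mXV : measurable_fun [set: Omega] (fun w => (X w, V w)).
Proof. exact: measurable_fun_pair. Qed.

Let rvX : {mfun Omega >-> R} := HB.pack X (isMeasurableFun.Build _ _ _ _ _ mX').
Let rvV : {mfun Omega >-> R} := HB.pack V (isMeasurableFun.Build _ _ _ _ _ mV).
Let rvXV : {mfun Omega >-> (R * R)%type} :=
  HB.pack (fun w => (X w, V w)) (isMeasurableFun.Build _ _ _ _ _ mXV).
Let PX : probability R R := distribution P rvX.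
Let PV : probability R R := distribution P rvV.
Let PXV : probability (R * R)%type R := distribution P rvXV.

(** Independence gives the equality on rectangles, and these determine a measure on the product. *)
Let product_law (B : set (R * R)) : measurable B -> (PX \x PV)%E B = PXV B.
Proof.
apply: product_measure_unique => A C mA mC.
rewrite /PXV /PX /PV /distribution /pushforward /= -XV//.
by rewrite -[X @^-1` A]setTI; exact: mX.
Qed.

Let integral_product_law (f : R * R -> \bar R) :
  (\int[PXV]_z f z = \int[PX \x PV]_z f z)%E.
Proof. by apply: eq_measure_integral => B mB _; exact/esym/product_law. Qed.

Lemma ge0_integral_indep : (forall w, 0 <= X w) -> (forall w, 0 <= V w) ->
  (\int[P]_w (X w * V w)%:E = \int[P]_w (X w)%:E * \int[P]_w (V w)%:E)%E.
Proof.
move=> X0 V0.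
(* Tonelli asks for integrands that are nonnegative on all of [R * R], not only on the range of
   [(X, V)]; the positive part provides this and changes nothing on that range. *)
pose p (x : R) : R := Num.max x 0.
have mp : measurable_fun [set: R] p by exact: measurable_maxr.
have p0 x : 0 <= p x by rewrite /p le_max lexx orbT.
have pE x : 0 <= x -> p x = x by move=> x0; rewrite /p; exact/max_idPl.
have mpE : measurable_fun [set: R] (fun x => (p x)%:E) by exact/measurable_EFinP.
transitivity (\int[PXV]_z ((p z.1)%:E * (p z.2)%:E))%E.
  rewrite ge0_integral_distribution//=; last 2 first.
  - apply: emeasurable_funM; apply: measurableT_comp mpE _ => //.
  - by move=> y; rewrite mule_ge0 ?lee_fin.
  by apply: eq_integral => w _ /=; rewrite !pE.
rewrite integral_product_law.
rewrite fubini_tonelli1//=; last 2 first.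
- apply: emeasurable_funM; apply: measurableT_comp mpE _ => //.
- by move=> y; rewrite mule_ge0 ?lee_fin.
rewrite /fubini_F/=.
have pE0 x : (0 <= (p x)%:E)%E by rewrite lee_fin.
under eq_integral => x _ do rewrite (ge0_integralZl _ _ _ (fun y _ => pE0 y) (pE0 x))//.
rewrite ge0_integralZr//; last exact: integral_ge0.
rewrite !ge0_integral_distribution//; try by move=> x; rewrite lee_fin.
by congr (_ * _)%E; apply: eq_integral => w _ /=; rewrite pE.
Qed.

Hypothesis iX : P.-integrable [set: Omega] (fun w => (X w)%:E).
Hypothesis iV : P.-integrable [set: Omega] (fun w => (V w)%:E).

Let integrable_prod : (PX \x PV)%E.-integrable [set: R * R] (fun z => (z.1 * z.2)%:E).
Proof.
apply/integrable12ltyP.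
  by apply/measurable_EFinP; apply: measurable_funM.
rewrite (_ : (fun x => _) = fun x : R => (`|x|%:E * \int[PV]_y `|y|%:E)%E); last first.
  apply/funext => x; rewrite -ge0_integralZl//.
    by apply: eq_integral => y _; rewrite /= normrM.
  by apply/measurable_EFinP; exact: normr_measurable.
have mn : measurable_fun [set: R] (fun x : R => `|x|%:E).
  by apply/measurable_EFinP; exact: normr_measurable.
rewrite ge0_integralZr//; last exact: integral_ge0.
have -> : (\int[PX]_x `|x|%:E = \int[P]_w `|(X w)%:E|)%E.
  by rewrite (ge0_integral_distribution rvX mn)// => x; rewrite lee_fin.
have -> : (\int[PV]_x `|x|%:E = \int[P]_w `|(V w)%:E|)%E.
  by rewrite (ge0_integral_distribution rvV mn)// => x; rewrite lee_fin.
apply: lte_mul_pinfty.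
- exact: integral_ge0.
- by rewrite ge0_fin_numE; [case/integrableP : iX|exact: integral_ge0].
- by case/integrableP : iV.
Qed.

Let mprod : measurable_fun [set: R * R] (fun z => (z.1 * z.2)%:E).
Proof. exact: measurable_int integrable_prod. Qed.

Let integrable_law : PXV.-integrable [set: R * R] (fun z => (z.1 * z.2)%:E).
Proof.
case/integrableP: integrable_prod => m1 m2; apply/integrableP; split => //.
by rewrite integral_product_law.
Qed.

Lemma integrable_indep : P.-integrable [set: Omega] (fun w => (X w * V w)%:E).
Proof.
case/integrableP: integrable_law => m1; rewrite ge0_integral_distribution//.
  move=> H; apply/integrableP; split => //.
  by apply/measurable_EFinP; exact: measurable_funM.
exact: measurableT_comp.
Qed.

Lemma Rintegral_indep :
  \int[P]_w (X w * V w) = (\int[P]_w X w) * (\int[P]_w V w).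
Proof.
rewrite /Rintegral.
rewrite [X in fine X = _](_ : _ = \int[PXV]_z (z.1 * z.2)%:E)%E; last first.
  by rewrite integral_distribution//; exact: integrable_indep.
rewrite integral_product_law.
rewrite -integral12_prod_meas1//.
have iPV : PV.-integrable [set: R] (fun y => y%:E).
  by apply: integrable_pushforward => //; exact/measurable_EFinP.
have iPX : PX.-integrable [set: R] (fun y => y%:E).
  by apply: integrable_pushforward => //; exact/measurable_EFinP.
rewrite [X in fine X = _](_ : _ = \int[PX]_x (x%:E * \int[PV]_y y%:E))%E; last first.
  by apply: eq_integral => x _; rewrite -integralZl.
have fV : (\int[PV]_y y%:E)%E \is a fin_num by exact: integrable_fin_num.
rewrite -(fineK fV) integralZr//= fineM ?integrable_fin_num//=.
by rewrite !integral_distribution.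
Qed.

End Independence.

(** * Square integrable products and limits under a pairing *)

Section Integration.
Context d (T : measurableType d) {R : realType} (mu : {measure set T -> \bar R}).

Lemma integrable_sqrM (f g : T -> R) :
  measurable_fun [set: T] f -> measurable_fun [set: T] g ->
  mu.-integrable setT (fun x => (f x ^+ 2)%:E) ->
  mu.-integrable setT (fun x => (g x ^+ 2)%:E) ->
  mu.-integrable setT (fun x => (f x * g x)%:E).
Proof.
move=> mf mg f2 g2; apply: le_integrable (integrableD measurableT f2 g2) => //.
  by apply/measurable_EFinP; exact: measurable_funM.
move=> x _ /=; rewrite lee_fin [leRHS]ger0_norm ?addr_ge0 ?sqr_ge0// ler_norml.
by have := sqr_ge0 (f x - g x); have := sqr_ge0 (f x + g x); nra.
Qed.

(** Integrability and value are proved together because additivity at each induction step needs the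
    integrability of the remaining sum. *)
Lemma Rintegral_sum (I : Type) (r : seq I) (Q : pred I) (f : I -> T -> R) :
  (forall i, Q i -> mu.-integrable setT (EFin \o f i)) ->
  mu.-integrable setT (fun x => (\sum_(i <- r | Q i) f i x)%:E) /\
  \int[mu]_x (\sum_(i <- r | Q i) f i x) = \sum_(i <- r | Q i) \int[mu]_x f i x.
Proof.
move=> If; elim: r => [|i r [IH1 IH2]].
  under eq_fun do rewrite big_nil; under eq_Rintegral do rewrite big_nil.
  by rewrite big_nil; split; [exact: integrable0|rewrite /Rintegral integral0].
under eq_fun do rewrite big_cons; under eq_Rintegral do rewrite big_cons.
rewrite big_cons; case: ifPn => // Qi; have Ii := If i Qi.
by split; [exact: (integrableD measurableT Ii IH1)|rewrite RintegralD// IH2].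
Qed.

(* AM-GM: [|k (f_n - f)| <= (e k^2 + (f_n - f)^2 / e) / 2]. *)
Lemma cvg_Rintegral_sqr (k f : T -> R) (f_ : nat -> T -> R) :
  measurable_fun [set: T] k -> measurable_fun [set: T] f ->
  (forall n, measurable_fun [set: T] (f_ n)) ->
  mu.-integrable setT (fun x => (k x ^+ 2)%:E) ->
  (forall n, mu.-integrable setT (fun x => (k x * f_ n x)%:E)) ->
  (fun n => \int[mu]_x ((f_ n x - f x) ^+ 2)%:E)%E @ \oo --> 0%E ->
  mu.-integrable setT (fun x => (k x * f x)%:E) /\
  (fun n => \int[mu]_x (k x * f_ n x)) @ \oo --> \int[mu]_x (k x * f x).
Proof.
move=> mk mf mf_ k2 kf_ f_f.
have mdiff n : measurable_fun [set: T] (fun x => f_ n x - f x) by exact: measurable_funB.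
have diff_fin n : (\int[mu]_x ((f_ n x - f x) ^+ 2)%:E < +oo)%E ->
    mu.-integrable setT (fun x => ((f_ n x - f x) ^+ 2)%:E).
  move=> H; apply/integrableP; split.
    by apply/measurable_EFinP; apply: measurable_funX.
  by under eq_integral do rewrite /= ger0_norm ?sqr_ge0//.
pose x_ n := fine (\int[mu]_x ((f_ n x - f x) ^+ 2)%:E)%E.
have /fine_cvgP[x_fin x_0] := f_f.
have kdiff n : (\int[mu]_x ((f_ n x - f x) ^+ 2)%:E)%E \is a fin_num ->
    mu.-integrable setT (fun x => (k x * (f_ n x - f x))%:E).
  move=> xn; apply: integrable_sqrM => //; apply: diff_fin.
  by move: xn; rewrite fin_numE ltey => /andP[].
have ikf : mu.-integrable setT (fun x => (k x * f x)%:E).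
  (* The distance to [f] is known to be finite only for late indices; one such [N] gives
     [k f = k f_N - k (f_N - f)]. *)
  have [N _ /(_ N (leqnn N)) /kdiff xN] := x_fin.
  have := integrableB measurableT (kf_ N) xN.
  by apply: eq_integrable => // x _; rewrite /= -EFinB; congr EFin; ring.
split => //; apply/cvgrPdist_le => e e0.
pose K := \int[mu]_x (k x ^+ 2).
have K0 : 0 <= K by apply: Rintegral_ge0 => x _; exact: sqr_ge0.
(* [c] weights the two terms of AM-GM: [c * K <= e] and, for late [n], [x_ n <= c * e] make each of
   them at most [e / 2]. Dividing by [K + 1] covers the case [K = 0]. *)
have [c c0 cK] : exists2 c, 0 < c & c * K <= e.
  exists (e / (K + 1)); first by rewrite divr_gt0// ltr_wpDl.
  by rewrite mulrAC ler_pdivrMr ?ltr_wpDl// mulrDr mulr1 lerDl ltW.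
near=> n.
have xn : (\int[mu]_x ((f_ n x - f x) ^+ 2)%:E)%E \is a fin_num by near: n.
have xn_le : x_ n <= c * e.
  near: n; have /cvgrPdist_le/(_ (c * e) (mulr_gt0 c0 e0)) := x_0.
  by apply: filterS => n; rewrite sub0r normrN; apply: le_trans; exact: ler_norm.
have sqn : mu.-integrable setT (fun x => ((f_ n x - f x) ^+ 2)%:E).
  by apply: diff_fin; move: xn; rewrite fin_numE ltey => /andP[].
have -> : \int[mu]_x (k x * f x) - \int[mu]_x (k x * f_ n x) =
    - \int[mu]_x (k x * (f_ n x - f x)).
  rewrite -(RintegralB measurableT ikf (kf_ n)) -mulN1r -RintegralZl//; last exact: kdiff.
  by apply: eq_Rintegral => x _; ring.
rewrite normrN; apply: le_trans (le_normr_Rintegral _ _) _ => //; first exact: kdiff.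
pose bound x := c / 2 * k x ^+ 2 + (2 * c)^-1 * (f_ n x - f x) ^+ 2.
have I1 := integrableZl measurableT (c / 2) k2.
have I2 := integrableZl measurableT (2 * c)^-1 sqn.
have : \int[mu]_x `|k x * (f_ n x - f x)| <= \int[mu]_x bound x.
  apply: le_Rintegral => //.
  - exact: (integrable_norm (kdiff n xn)).
  - exact: (integrableD measurableT I1 I2).
  move=> x _; rewrite /bound; set u := k x; set v := f_ n x - f x.
  have -> : c / 2 * u ^+ 2 + (2 * c)^-1 * v ^+ 2 =
     ((c * `|u| - `|v|) ^+ 2 / (2 * c) + `|u| * `|v|).
    rewrite -(real_normK (num_real u)) -(real_normK (num_real v)); field.
    by rewrite gt_eqF.
  by rewrite normrM lerDr divr_ge0 ?sqr_ge0// mulr_ge0// ltW.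
move=> /le_trans; apply; rewrite RintegralD// !RintegralZl// -/K.
have -> : \int[mu]_x ((f_ n x - f x) ^+ 2) = x_ n by [].
have : (2 * c)^-1 * x_ n <= e / 2.
  rewrite ler_pdivrMl ?mulr_gt0//; apply: le_trans xn_le _.
  by rewrite le_eqVlt; apply/orP; left; apply/eqP; field.
by rewrite (_ : c / 2 * K = (c * K) / 2); [lra|ring].
Unshelve. all: by end_near.
Qed.

End Integration.

(** * Products of a time indicator and a random variable *)

Section Rectangle.
Context {R : realType} d (Omega : measurableType d) (P : probability Omega R).
Local Notation mu := (@lebesgue_measure R).

Lemma lebesgue_measure_itvoc (a b : R) : a <= b -> mu `]a, b]%classic = (b - a)%:E.
Proof.
rewrite le_eqVlt => /predU1P[->|ab]; first by rewrite set_itvoc0 measure0 subrr.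
by rewrite lebesgue_measure_itv/= lte_fin ab EFinB.
Qed.

Lemma integral_rectangle (B : set R) (b : R) (c : Omega -> R) :
  measurable B -> mu B = b%:E -> P.-integrable setT (EFin \o c) ->
  (mu \x P)%E.-integrable setT (fun z => (\1_B z.1 * c z.2)%:E) /\
  \int[(mu \x P)%E]_z (\1_B z.1 * c z.2) = b * \int[P]_w c w.
Proof.
move=> mB muB ic.
have mc : measurable_fun setT c by apply/measurable_EFinP; exact: measurable_int ic.
have iB : mu.-integrable setT (fun x => (\1_B x)%:E).
  apply/integrableP; split; first exact/measurable_EFinP.
  under eq_integral do rewrite /= ger0_norm//.
  by rewrite integral_indic// setIT/= muB ltry.
have I : (mu \x P)%E.-integrable setT (fun z => (\1_B z.1 * c z.2)%:E).
  apply/integrable12ltyP.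
    apply/measurable_EFinP; apply: measurable_funM.
      by apply: measurableT_comp.
    by apply: measurableT_comp.
  have E x : (\int[P]_y `|(\1_B x * c y)%:E| =
      (\1_B x)%:E * \int[P]_y `|(c y)%:E|)%E.
    rewrite -ge0_integralZl//.
    - by apply: eq_integral => y _ /=; rewrite normrM EFinM ger0_norm.
    - by apply/measurable_EFinP; exact: measurableT_comp.
  under eq_integral do rewrite /= E.
  rewrite ge0_integralZr//; [|exact/measurable_EFinP|exact: integral_ge0].
  rewrite integral_indic// setIT/= muB lte_mul_pinfty//.
  - by rewrite -muB.
  - by case/integrableP : ic.
split => //; rewrite /Rintegral -integral12_prod_meas1//.
have fc : (\int[P]_w (c w)%:E)%E \is a fin_num by exact: integrable_fin_num.
rewrite [X in fine X = _](_ : _ =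
    \int[mu]_x ((\1_B x)%:E * \int[P]_w (c w)%:E))%E; last first.
  by apply: eq_integral => x _; rewrite -integralZl.
by rewrite -(fineK fc) integralZr// integral_indic// setIT/= muB.
Qed.

End Rectangle.

(** * Convex functions and superquadratic growth *)

Section Convex.
Context {R : realType}.
Implicit Types f : R -> R.

Lemma convex_function_le f (t x y : R) : @convex_function R R^o setT f ->
  0 <= t <= 1 -> f (t * x + (1 - t) * y) <= t * f x + (1 - t) * f y.
Proof.
move=> cf /andP[t0 t1]; have := cf (Itv01 t0 t1) x y.
by rewrite !in_setT !convRE; apply.
Qed.

(** Sublevel sets of a convex function are intervals, hence Borel, and their complements are the
    preimages of the open rays that generate the Borel sets. *)
Lemma convex_measurable_fun f : @convex_function R R^o setT f ->
  measurable_fun [set: R] f.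
Proof.
move=> cf; have mle r : measurable [set x | f x <= r].
  apply: is_interval_measurable => x y /= fx fy z /andP[xz zy].
  have [xy|xy] := eqVneq x y.
    by have -> : z = x; [lra|].
  have yx : 0 < y - x by rewrite subr_gt0 lt_neqAle xy (le_trans xz zy).
  pose t := (y - z) / (y - x).
  have t01 : 0 <= t <= 1.
    by rewrite divr_ge0 ?ler_pdivrMr ?mul1r//; lra.
  have -> : z = t * x + (1 - t) * y by rewrite /t; field; rewrite gt_eqF.
  have := convex_function_le x y cf t01; move: t01 => /andP[]; nra.
move=> mT; apply: (measurability _ (RGenOInfty.measurableE R)) => //.
move=> _ [_ [r ->] <-]; rewrite setTI.
rewrite (_ : _ @^-1` _ = ~` [set x | f x <= r]); first exact: measurableC.
by apply/seteqP; split => x /=; rewrite in_itv/= andbT ltNge => /negP.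
Qed.

(** Otherwise [K] bounds the ratio on the neighbourhood [M < |z|] of infinity, and hence bounds the
    limit superior. *)
Lemma limf_esup_norm_infty f (K M : R) :
  limf_esup (fun z : R => (f z / `|z| ^+ 2)%:E) (norm_infty_nbhs R) = +oo%E ->
  exists2 z, M < `|z| & K < f z / `|z| ^+ 2.
Proof.
move=> lim; apply: contrapT => nz.
suff : (limf_esup (fun z : R => (f z / `|z| ^+ 2)%:E) (norm_infty_nbhs R) <= K%:E)%E.
  by rewrite lim leye_eq.
apply: (@le_trans _ _ (ereal_sup
    [set (f z / `|z| ^+ 2)%:E | z in [set z : R | M < `|z|]])).
  by apply: ereal_inf_lbound; exists [set z : R | M < `|z|] => //; exists M.
apply: ge_ereal_sup => _ [z /= Mz <-]; rewrite lee_fin leNgt; apply/negP => Kz.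
by apply: nz; exists z.
Qed.

(* Taking [q = K z] with [f z > K z^2] keeps the conjugate of [f] at [q] below
   [K z^2], and [h] is then fixed by [q^2 h = 4 b]. *)
Lemma superquadratic_drift f (b K eta : R) : (forall z, 0 <= f z) -> f 0 = 0 ->
  @convex_function R R^o setT f ->
  limf_esup (fun z : R => (f z / `|z| ^+ 2)%:E) (norm_infty_nbhs R) = +oo%E ->
  0 < b -> 0 < K -> 0 < eta ->
  exists q kappa h : R, [/\ 0 < h, h <= eta, forall z, q * z - f z <= kappa,
    kappa * h = 4 * b / K & q ^+ 2 * h = 4 * b].
Proof.
move=> f0 f00 cf lim b0 K0 eta0.
(* The bound [1] gives [z != 0] and [|z| <= z ^+ 2]; the other one then makes [h = 4 b / (K z)^2] at
   most [eta]. *)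
pose M := Num.max 1 (4 * b / (K ^+ 2 * eta)).
have [z Mz Kz] := limf_esup_norm_infty K M lim.
have M1 : 1 <= M by rewrite /M le_max lexx.
have ME : 4 * b <= M * (K ^+ 2 * eta).
  by rewrite -ler_pdivrMr ?mulr_gt0 ?exprn_gt0// /M le_max lexx orbT.
have z1 : 1 < `|z| by exact: le_lt_trans Mz.
have zn0 : z != 0 by rewrite -normr_gt0 (lt_trans ltr01).
have z2 : 0 < z ^+ 2 by rewrite exprn_even_gt0//= zn0.
have fz : K * z ^+ 2 < f z.
  by rewrite -ltr_pdivlMr// -(real_normK (num_real z)).
exists (K * z), (K * z ^+ 2), (4 * b / (K * z) ^+ 2).
have Kz2 : 0 < (K * z) ^+ 2 by rewrite exprMn mulr_gt0// exprn_gt0.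
split.
- by rewrite divr_gt0// mulr_gt0.
- rewrite ler_pdivrMr// (le_trans ME)// (_ : eta * _ = z ^+ 2 * (K ^+ 2 * eta)); last by ring.
  rewrite ler_wpM2r ?mulr_ge0 ?sqr_ge0// ?ltW//.
  by rewrite -(real_normK (num_real z)) expr2; nra.
(* If [y * z <= z ^+ 2], then [0 <= f y] suffices. Otherwise [z = t * y] lies between [0] and [y],
   and convexity with [f 0 = 0] gives [K * z ^+ 2 < f z <= t * f y], that is [q * y < f y]. *)
- move=> y; have fy := f0 y.
  have [yz|zy] := leP (y * z) (z ^+ 2).
    by have : K * (y * z) <= K * z ^+ 2; [rewrite ler_wpM2l// ltW|lra].
  have yz0 : 0 < y * z by exact: lt_trans zy.
  pose t := z ^+ 2 / (y * z).
  have t01 : 0 <= t <= 1.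
    by apply/andP; split; [apply: divr_ge0; exact: ltW|rewrite ler_pdivrMr// mul1r ltW].
  have yn0 : y != 0 by apply: contraTneq yz0 => ->; rewrite mul0r ltxx.
  have tz : t * y + (1 - t) * 0 = z by rewrite /t mulr0 addr0; field; rewrite zn0 yn0.
  have := convex_function_le y 0 cf t01; rewrite tz f00 mulr0 addr0 => fzt.
  have : K * z ^+ 2 < t * f y by exact: lt_le_trans fzt.
  rewrite /t mulrAC ltr_pdivlMr// mulrAC [_ * f y]mulrC ltr_pM2r// => H.
  have : 0 <= K * z ^+ 2 by rewrite mulr_ge0 ?ltW.
  by move: H; rewrite [y * z]mulrC mulrA; lra.
- by field; rewrite zn0 gt_eqF.
- by field; rewrite zn0 gt_eqF.
Qed.

End Convex.

(** * The augmented filtration and the Brownian increments *)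

Section Brownian.
Context {R : realType} d (Omega : measurableType d) (P : probability Omega R).
Hypothesis P_complete : measure_is_complete P.
Variable W : R -> Omega -> R.
Local Notation F := (augmented_natural_filtration P W).
Hypothesis W_bm : brownian_motion P F W.
Implicit Types (a q s t T : R) (X : Omega -> R).

Lemma filtration_gen t : <<s F t>> = F t.
Proof. exact/sigma_algebra_id/smallest_sigma_algebra. Qed.

(** Completeness of [P] makes the added negligible sets measurable. *)
Lemma filtration_measurable t : 0 <= t -> <<s F t>> `<=` measurable.
Proof.
move=> t0; rewrite filtration_gen; apply: smallest_sub.
  exact: sigma_algebra_measurable.
move=> A [[s [B [s0 st mB ->]]]|nA]; last exact: P_complete.
by rewrite -[_ @^-1` _]setTI; exact: (bm_measurable W_bm).
Qed.

Lemma filtration_le s t : s <= t -> <<s F s>> `<=` <<s F t>>.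
Proof.
move=> st; rewrite !filtration_gen; apply: sub_sigma_algebra2 => A [[u [B [u0 us mB ->]]]|nA].
  by left; exists u, B; split => //; exact: le_trans us st.
by right.
Qed.

Lemma measurable_wrt_filtration s t X : s <= t ->
  measurable_wrt (F s) X -> measurable_wrt (F t) X.
Proof. by move=> st; apply: measurable_wrt_sub; exact: filtration_le. Qed.

Lemma measurable_wrt_bm s t : 0 <= s -> s <= t -> measurable_wrt (F t) (W s).
Proof. by move=> s0 st; apply: measurable_wrt_filtration st _; exact: (bm_adapted W_bm). Qed.

Lemma measurable_fun_filtration t X : 0 <= t -> measurable_wrt (F t) X ->
  measurable_fun [set: Omega] X.
Proof. by move=> t0; apply: measurable_wrt_measurable; exact: filtration_measurable. Qed.

Section Increment.
Variables (s t : R).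
Hypotheses (s0 : 0 <= s) (st : s < t).
Local Notation V := (fun w => W t w - W s w).

Lemma measurable_increment : measurable_fun [set: Omega] V.
Proof.
by apply: measurable_funB; apply: (bm_measurable W_bm) => //; exact: le_trans s0 (ltW st).
Qed.

Let s1 : Num.sqrt (t - s) != 0.
Proof. by rewrite gt_eqF// sqrtr_gt0 subr_gt0. Qed.

Let law (B : set R) : measurable B ->
  pushforward P V B = normal_prob 0 (Num.sqrt (t - s)) B.
Proof. by move=> mB; rewrite /pushforward (bm_normal W_bm). Qed.

Lemma ge0_integral_increment (f : R -> R) : measurable_fun [set: R] f ->
  (forall x, 0 <= f x) ->
  (\int[P]_w (f (W t w - W s w))%:E =
   \int[normal_prob 0 (Num.sqrt (t - s))]_x (f x)%:E)%E.
Proof.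
move=> mf f0; have mV := measurable_increment.
rewrite -(@ge0_integral_pushforward _ _ _ (measurableTypeR R) _ V mV P setT (EFin \o f))//=.
- by apply: eq_measure_integral => B mB _; exact: law.
- exact/measurable_EFinP.
- by move=> x _; rewrite lee_fin.
Qed.

Lemma integrable_increment (f : R -> R) : measurable_fun [set: R] f ->
  (normal_prob 0 (Num.sqrt (t - s))).-integrable setT (EFin \o f) ->
  P.-integrable setT (fun w => (f (W t w - W s w))%:E).
Proof.
move=> mf /integrableP[_ foo]; apply/integrableP; split.
  by apply/measurable_EFinP; apply: measurableT_comp mf measurable_increment.
have := @ge0_integral_increment (fun x => `|f x|); rewrite /= => -> //.
exact: measurableT_comp.
Qed.

Lemma Rintegral_increment (f : R -> R) : measurable_fun [set: R] f ->
  (normal_prob 0 (Num.sqrt (t - s))).-integrable setT (EFin \o f) ->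
  \int[P]_w f (W t w - W s w) =
  \int[normal_prob 0 (Num.sqrt (t - s))]_x f x.
Proof.
move=> mf If; have mV := measurable_increment.
congr fine.
rewrite -(@integral_pushforward _ _ _ (measurableTypeR R) _ V mV P setT (EFin \o f))//=.
- by apply: eq_measure_integral => B mB _; exact: law.
- exact/measurable_EFinP.
- exact: integrable_increment.
Qed.

Lemma integrable_expR_increment q :
  P.-integrable setT (fun w => (expR (q * (W t w - W s w)))%:E).
Proof.
apply: (@integrable_increment (fun x => expR (q * x))).
  by apply: measurableT_comp => //; exact: measurable_funM.
exact: integrable_normal_expR.
Qed.

Lemma Rintegral_expR_increment q :
  \int[P]_w expR (q * (W t w - W s w)) = expR (q ^+ 2 * (t - s) / 2).
Proof.
rewrite (@Rintegral_increment (fun x => expR (q * x))).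
- by rewrite /Rintegral normal_mgf//= sqr_sqrtr// subr_ge0 ltW.
- by apply: measurableT_comp => //; exact: measurable_funM.
- exact: integrable_normal_expR.
Qed.

Lemma integrable_mul_expR_increment q : P.-integrable setT
  (fun w => ((W t w - W s w) * expR (q * (W t w - W s w)))%:E).
Proof.
apply: (@integrable_increment (fun x => x * expR (q * x))).
  by apply: measurable_funM => //; apply: measurableT_comp => //; exact: measurable_funM.
exact: integrable_normal_idexpR.
Qed.

Lemma Rintegral_mul_expR_increment q :
  \int[P]_w ((W t w - W s w) * expR (q * (W t w - W s w))) =
  q * (t - s) * expR (q ^+ 2 * (t - s) / 2).
Proof.
rewrite (@Rintegral_increment (fun x => x * expR (q * x))).
- by rewrite normal_mgf_derive//= sqr_sqrtr// subr_ge0 ltW.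
- by apply: measurable_funM => //; apply: measurableT_comp => //; exact: measurable_funM.
- exact: integrable_normal_idexpR.
Qed.

Lemma increment_indep (f : R -> R) (A : set Omega) (B : set R) :
  measurable_fun [set: R] f -> <<s F s>> A -> measurable B ->
  P (A `&` (fun w => f (W t w - W s w)) @^-1` B) =
  (P A * P ((fun w => f (W t w - W s w)%R) @^-1` B))%E.
Proof.
move=> mf; rewrite filtration_gen => FA mB.
have mfB : measurable (f @^-1` B) by rewrite -[X in measurable X]setTI; exact: mf.
exact: (bm_independent W_bm s0 st FA mfB).
Qed.

End Increment.

(** * The exponential martingale *)

(* The density on [F t] of the law under which [W] gets the drift [q] on [[s, t]]. *)
Definition drift_density q s t (w : Omega) : R :=
  expR (q * (W t w - W s w) - q ^+ 2 * (t - s) / 2).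

Lemma drift_densityE q s t w : drift_density q s t w =
  expR (- (q ^+ 2 * (t - s) / 2)) * expR (q * (W t w - W s w)).
Proof. by rewrite /drift_density expRD mulrC. Qed.

Lemma drift_density_gt0 q s t w : 0 < drift_density q s t w.
Proof. exact: expR_gt0. Qed.

Lemma drift_density_id q s w : drift_density q s s w = 1.
Proof. by rewrite /drift_density !subrr !mulr0 mul0r subr0 expR0. Qed.

Lemma drift_density0 s t w : drift_density 0 s t w = 1.
Proof. by rewrite /drift_density mul0r expr0n/= !mul0r subr0 expR0. Qed.

Lemma drift_density_trans q r s t w :
  drift_density q r t w = drift_density q r s w * drift_density q s t w.
Proof. by rewrite /drift_density -expRD; congr expR; field. Qed.

Lemma measurable_wrt_drift_density q s t u : 0 <= s -> s <= t -> t <= u ->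
  measurable_wrt (F u) (drift_density q s t).
Proof.
move=> s0 st tu; have t0 := le_trans s0 st.
have mV : measurable_wrt (F u) (fun w => W t w - W s w).
  by apply: measurable_wrtB; apply: measurable_wrt_bm => //; exact: le_trans st tu.
apply: (measurable_wrt_comp (f := fun x => expR (q * x - q ^+ 2 * (t - s) / 2)) _ mV).
by apply: measurableT_comp => //; apply: measurable_funB => //; exact: measurable_funM.
Qed.

Lemma measurable_drift_density q s t : 0 <= s -> s <= t ->
  measurable_fun setT (drift_density q s t).
Proof.
move=> s0 st; apply: (@measurable_fun_filtration t); first exact: le_trans st.
exact: measurable_wrt_drift_density.
Qed.

Lemma integrable_drift_density q s t : 0 <= s -> s <= t ->
  P.-integrable setT (fun w => (drift_density q s t w)%:E).
Proof.
move=> s0; rewrite le_eqVlt => /predU1P[<-|st].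
  under eq_fun do rewrite drift_density_id.
  exact: finite_measure_integrable_cst.
under eq_fun do rewrite drift_densityE EFinM.
apply: integrableZl => //; exact: integrable_expR_increment.
Qed.

Lemma Rintegral_drift_density q s t : 0 <= s -> s <= t ->
  \int[P]_w drift_density q s t w = 1.
Proof.
move=> s0; rewrite le_eqVlt => /predU1P[<-|st].
  under eq_Rintegral do rewrite drift_density_id.
  by rewrite Rintegral_cst//= probability_setT mulr1.
under eq_Rintegral do rewrite drift_densityE.
rewrite RintegralZl//; last exact: integrable_expR_increment.
by rewrite Rintegral_expR_increment// -expRD addNr expR0.
Qed.

(** The square is a constant multiple of the density with drift [2 * q]. Square integrability
    qualifies the density as the fixed factor in [cvg_Rintegral_sqr]. *)
Lemma integrable_drift_density_sq q s t : 0 <= s -> s <= t ->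
  P.-integrable setT (fun w => (drift_density q s t w ^+ 2)%:E).
Proof.
move=> s0 st.
have E w : drift_density q s t w ^+ 2 =
    expR (q ^+ 2 * (t - s)) * drift_density (2 * q) s t w.
  by rewrite expr2 /drift_density -!expRD; congr expR; field.
under eq_fun do rewrite E EFinM.
by apply: integrableZl => //; exact: integrable_drift_density.
Qed.

Lemma integrable_mul_drift_density q s t X : 0 <= s -> s <= t ->
  measurable_wrt (F s) X -> P.-integrable setT (EFin \o X) ->
  P.-integrable setT (fun w => (X w * drift_density q s t w)%:E).
Proof.
move=> s0; rewrite le_eqVlt => /predU1P[<-|st] mX iX.
  by under eq_fun do rewrite drift_density_id mulr1.
pose f x := expR (q * x - q ^+ 2 * (t - s) / 2).
have mf : measurable_fun [set: R] f.
  by apply: measurableT_comp => //; apply: measurable_funB => //; exact: measurable_funM.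
apply: (integrable_indep (filtration_measurable s0) mX) => //.
- exact: measurable_drift_density (ltW st).
- by move=> A B; exact: (increment_indep s0 st mf).
- exact: integrable_drift_density (ltW st).
Qed.

(** The density over [[s, t]] is independent of [F s] and has mean one, so a drift that starts at
    [s] is invisible to variables known at [s]. *)
Lemma Rintegral_mul_drift_density q s t X : 0 <= s -> s <= t ->
  measurable_wrt (F s) X -> P.-integrable setT (EFin \o X) ->
  \int[P]_w (X w * drift_density q s t w) = \int[P]_w X w.
Proof.
move=> s0; rewrite le_eqVlt => /predU1P[<-|st] mX iX.
  by under eq_Rintegral do rewrite drift_density_id mulr1.
pose f x := expR (q * x - q ^+ 2 * (t - s) / 2).
have mf : measurable_fun [set: R] f.
  by apply: measurableT_comp => //; apply: measurable_funB => //; exact: measurable_funM.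
rewrite (Rintegral_indep (filtration_measurable s0) mX)
  ?(Rintegral_drift_density _ s0 (ltW st)) ?mulr1//.
- exact: measurable_drift_density (ltW st).
- by move=> A B; exact: (increment_indep s0 st mf).
- exact: integrable_drift_density (ltW st).
Qed.

(** Nonnegativity replaces integrability here, as the latter is not known for the running cost at a
    fixed time. *)
Lemma ge0_integral_mul_drift_density q s t X : 0 <= s -> s <= t ->
  measurable_wrt (F s) X -> (forall w, 0 <= X w) ->
  (\int[P]_w (X w * drift_density q s t w)%:E = \int[P]_w (X w)%:E)%E.
Proof.
move=> s0; rewrite le_eqVlt => /predU1P[<-|st] mX X0.
  by under eq_integral do rewrite drift_density_id mulr1.
pose f x := expR (q * x - q ^+ 2 * (t - s) / 2).
have mf : measurable_fun [set: R] f.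
  by apply: measurableT_comp => //; apply: measurable_funB => //; exact: measurable_funM.
rewrite (ge0_integral_indep (filtration_measurable s0) mX)//.
- rewrite -[X in (_ * X)%E]fineK; last first.
    exact/integrable_fin_num/integrable_drift_density/ltW.
  have := Rintegral_drift_density q s0 (ltW st).
  by rewrite /Rintegral => ->; rewrite mule1.
- exact: measurable_drift_density (ltW st).
- by move=> A B; exact: (increment_indep s0 st mf).
- by move=> w; exact/ltW/drift_density_gt0.
Qed.

(** By independence only the mean of the increment under the drift matters, and this is the
    normalized derivative of the moment generating function. The case [q = 0] is the martingale
    property of [W]. *)
Lemma drift_density_increment q s t X : 0 <= s -> s <= t ->
  measurable_wrt (F s) X -> P.-integrable setT (EFin \o X) ->
  P.-integrable setT
    (fun w => (X w * ((W t w - W s w) * drift_density q s t w))%:E) /\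
  \int[P]_w (X w * ((W t w - W s w) * drift_density q s t w)) =
  q * (t - s) * \int[P]_w X w.
Proof.
move=> s0; rewrite le_eqVlt => /predU1P[<-|st] mX iX.
  have E w : X w * ((W s w - W s w) * drift_density q s s w) = 0.
    by rewrite subrr mul0r mulr0.
  split; first by under eq_fun do rewrite E; exact: integrable0.
  under eq_Rintegral do rewrite E.
  by rewrite Rintegral_cst// subrr mulr0 !mul0r.
pose f x := x * expR (q * x - q ^+ 2 * (t - s) / 2).
have mf : measurable_fun [set: R] f.
  apply: measurable_funM => //.
  by apply: measurableT_comp => //; apply: measurable_funB => //; exact: measurable_funM.
have E w : (W t w - W s w) * drift_density q s t w =
   expR (- (q ^+ 2 * (t - s) / 2)) * ((W t w - W s w) * expR (q * (W t w - W s w))).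
  by rewrite drift_densityE mulrCA.
have mV := measurable_increment s0 st.
have ifV : P.-integrable setT (fun w => (f (W t w - W s w))%:E).
  under eq_fun do rewrite /f -/(drift_density q s t _) E EFinM.
  by apply: integrableZl => //; exact: integrable_mul_expR_increment.
have mfV : measurable_fun setT (fun w => f (W t w - W s w)) by exact: measurableT_comp.
have indep A B := @increment_indep s t s0 st f A B mf.
split; first exact: (integrable_indep (filtration_measurable s0) mX mfV indep).
rewrite (Rintegral_indep (filtration_measurable s0) mX mfV indep)// mulrC; congr (_ * _).
under eq_Rintegral do rewrite /f -/(drift_density q s t _) E.
rewrite RintegralZl//; last exact: integrable_mul_expR_increment.
by rewrite Rintegral_mul_expR_increment// mulrCA -expRD addNr expR0 mulr1.
Qed.

Lemma integrable_bounded_wrt s X (M : R) : 0 <= s -> measurable_wrt (F s) X ->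
  (forall w, `|X w| <= M) -> P.-integrable setT (EFin \o X).
Proof.
move=> s0 mX XM; have mX' := measurable_fun_filtration s0 mX.
apply: le_integrable (finite_measure_integrable_cst P `|M| measurableT) => //.
  exact/measurable_EFinP.
by move=> w _ /=; rewrite lee_fin normr_id (le_trans (XM w)) ?ler_norm.
Qed.

(** * Effect of the drift on one step of a simple process *)

Section Step.
Variables (q a T : R).
Hypotheses (a0 : 0 <= a) (aT : a <= T).
Local Notation D := (drift_density q a T).

Section Fixed.
Variables (s t : R) (X : Omega -> R) (M : R).
Hypotheses (s0 : 0 <= s) (st : s <= t) (tT : t <= T).
Hypotheses (mX : measurable_wrt (F s) X) (XM : forall w, `|X w| <= M).

Let iX : P.-integrable setT (EFin \o X).
Proof. exact: (integrable_bounded_wrt s0 mX XM). Qed.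

Lemma integrable_drift_coef : P.-integrable setT (fun w => (D w * X w)%:E).
Proof.
have iD := integrable_drift_density q a0 aT.
have mX' : measurable_fun setT X by exact: measurable_fun_filtration mX.
apply: le_integrable (integrableZl measurableT M iD) => //.
  by apply/measurable_EFinP/measurable_funM => //; exact: measurable_drift_density.
move=> w _ /=; rewrite lee_fin !normrM mulrC ler_wpM2r//.
by rewrite (le_trans (XM w)) ?ler_norm.
Qed.

(** Factor [D] over [[a, s]], [[s, t]] and [[t, T]]: the first factor joins [X] as a variable known
    at [s], the second gives the increment its mean, and the third has mean one given [F t]. *)
Lemma drift_step_after : a <= s ->
  P.-integrable setT (fun w => (D w * (X w * (W t w - W s w)))%:E) /\
  \int[P]_w (D w * (X w * (W t w - W s w))) = q * (t - s) * \int[P]_w (D w * X w).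
Proof.
move=> las; pose X1 w := X w * drift_density q a s w.
have mDas : measurable_wrt (F s) (drift_density q a s).
  exact: measurable_wrt_drift_density.
have mX1 : measurable_wrt (F s) X1 by exact: measurable_wrtM.
have iX1 : P.-integrable setT (EFin \o X1).
  have iD := integrable_drift_density q a0 las.
  apply: le_integrable (integrableZl measurableT M iD) => //.
    by apply/measurable_EFinP; exact: measurable_fun_filtration mX1.
  move=> w _ /=; rewrite lee_fin !normrM ler_wpM2r//.
  by rewrite (le_trans (XM w)) ?ler_norm.
have [iX2 X2E] := drift_density_increment q s0 st mX1 iX1.
set X2 := (X in Rintegral P setT X) in X2E.
have t0 := le_trans s0 st.
have mX2 : measurable_wrt (F t) X2.
  apply: measurable_wrtM; first exact: measurable_wrt_filtration mX1.
  apply: measurable_wrtM; last exact: measurable_wrt_drift_density.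
  by apply: measurable_wrtB; exact: measurable_wrt_bm.
have E w : D w * (X w * (W t w - W s w)) = X2 w * drift_density q t T w.
  rewrite /X2 /X1 (drift_density_trans q a s T) (drift_density_trans q s t T).
  ring.
have E1 w : D w * X w = X1 w * drift_density q s T w.
  by rewrite /X1 (drift_density_trans q a s T); ring.
split; first by under eq_fun do rewrite E; exact: integrable_mul_drift_density.
under eq_Rintegral do rewrite E.
under [in RHS]eq_Rintegral do rewrite E1.
rewrite Rintegral_mul_drift_density// X2E Rintegral_mul_drift_density//.
exact: le_trans st tT.
Qed.

(** The drift starts only after the step, so [D] drops out and the centred increment remains. *)
Lemma drift_step_before : t <= a ->
  P.-integrable setT (fun w => (D w * (X w * (W t w - W s w)))%:E) /\
  \int[P]_w (D w * (X w * (W t w - W s w))) = 0.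
Proof.
move=> ta; have [iX2 X2E] := drift_density_increment 0 s0 st mX iX.
set X2 := (X in Rintegral P setT X) in X2E.
have t0 := le_trans s0 st.
have mX2 : measurable_wrt (F a) X2.
  apply: measurable_wrtM; first exact: measurable_wrt_filtration (le_trans st ta) mX.
  apply: measurable_wrtM; last exact: measurable_wrt_drift_density.
  by apply: measurable_wrtB; apply: measurable_wrt_bm => //; exact: le_trans st ta.
have E w : D w * (X w * (W t w - W s w)) = X2 w * D w.
  by rewrite /X2 drift_density0; ring.
split; first by under eq_fun do rewrite E; exact: integrable_mul_drift_density.
under eq_Rintegral do rewrite E.
by rewrite Rintegral_mul_drift_density// X2E !mul0r.
Qed.

End Fixed.

(** The difference of the maxima is the length of the part of [[s, t]] after [a]; a step that
    straddles [a] is cut there. *)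
Lemma drift_step s t X (M : R) : 0 <= s -> s <= t -> t <= T ->
  measurable_wrt (F s) X -> (forall w, `|X w| <= M) ->
  P.-integrable setT (fun w => (D w * (X w * (W t w - W s w)))%:E) /\
  \int[P]_w (D w * (X w * (W t w - W s w))) =
    q * (Num.max a t - Num.max a s) * \int[P]_w (D w * X w).
Proof.
move=> s0 st tT mX XM; have [las|lsa] := leP a s.
  rewrite max_r ?(le_trans las)//.
  exact: drift_step_after mX XM las.
have [lta|lat] := leP t a.
  rewrite subrr mulr0 mul0r.
  exact: drift_step_before mX XM lta.
have mXa : measurable_wrt (F a) X by exact: measurable_wrt_filtration (ltW lsa) mX.
have [i1 e1] := drift_step_before s0 (ltW lsa) mX XM (lexx a).
have [i2 e2] := drift_step_after a0 (ltW lat) tT mXa XM (lexx a).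
have E w : D w * (X w * (W t w - W s w)) =
    D w * (X w * (W a w - W s w)) + D w * (X w * (W t w - W a w)) by ring.
split; first by under eq_fun do rewrite E; exact: (integrableD measurableT i1 i2).
under eq_Rintegral do rewrite E.
by rewrite RintegralD// e1 add0r e2.
Qed.

End Step.

(** * Girsanov's formula, from simple integrands to Ito integrals *)

Lemma sp_time_in (T : R) (H : simple_process F 0 T) i : (i <= sp_size H)%N ->
  0 <= sp_time H i <= T.
Proof.
move=> iH; have mono k j : (k <= j)%N -> (j <= sp_size H)%N -> sp_time H k <= sp_time H j.
  elim: j => [|j IH]; first by rewrite leqn0 => /eqP->.
  rewrite leq_eqVlt => /predU1P[->//|kj] jH.
  by rewrite (le_trans (IH kj (ltnW jH)))// sp_mono.
have : sp_time H 0%N <= sp_time H i <= sp_time H (sp_size H) by rewrite !mono.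
by rewrite sp_first sp_last.
Qed.

Local Notation mu := (@lebesgue_measure R).

(** This is the sum of [drift_step] over the steps. The right-hand side is an integral over
    [mu \x P] so that both sides are continuous for the two convergences in [is_ito_integral]. *)
Lemma drift_simple q a T (H : simple_process F 0 T) : 0 <= a -> a <= T ->
  let D := drift_density q a T in
  [/\ P.-integrable setT (fun w => (D w * simple_integral W H w)%:E),
    (mu \x P)%E.-integrable setT
      (fun z => (\1_(`]a, T]%classic) z.1 * D z.2 * simple_eval H z.1 z.2)%:E) &
    \int[P]_w (D w * simple_integral W H w) =
    q * \int[(mu \x P)%E]_z
      (\1_(`]a, T]%classic) z.1 * D z.2 * simple_eval H z.1 z.2)].
Proof.
move=> a0 aT D.
have [M HM] := sp_bound H.
have HM' i : (i < sp_size H)%N -> forall w, `|sp_coef H i w| <= M by move=> iH w; exact: HM.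
(* The maxima cut the [i]-th step to the times after [a]; [B i] is empty when the step ends before
   [a]. *)
pose B i : set R := `]Num.max a (sp_time H i), Num.max a (sp_time H i.+1)]%classic.
have E1 w : D w * simple_integral W H w = \sum_(i < sp_size H)
    D w * (sp_coef H i w * (W (sp_time H i.+1) w - W (sp_time H i) w)).
  by rewrite /simple_integral mulr_sumr.
have tin i : (i <= sp_size H)%N -> 0 <= sp_time H i by move=> /sp_time_in/andP[].
have tle i : (i <= sp_size H)%N -> sp_time H i <= T by move=> /sp_time_in/andP[].
have E2 z : \1_(`]a, T]%classic) z.1 * D z.2 * simple_eval H z.1 z.2 =
    \sum_(i < sp_size H) \1_(B i) z.1 * (D z.2 * sp_coef H i z.2).
  rewrite /simple_eval mulr_sumr; apply: eq_bigr => i _.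
  have -> : \1_(B i) z.1 = \1_(`]a, T]%classic) z.1 *
      \1_(`](sp_time H i), (sp_time H i.+1)]%classic) z.1 :> R.
    have tT := tle i.+1 (ltn_ord i).
    have -> : B i = `]a, T]%classic `&` `](sp_time H i), (sp_time H i.+1)]%classic.
      apply/seteqP; split => x; rewrite /B /= !in_itv/= gt_max le_max.
        move=> /andP[/andP[ax tx] /orP[xa|xt]]; split; apply/andP; split => //; lra.
      by move=> [/andP[ax xT] /andP[tx xt]]; rewrite ax tx xt orbT.
    by rewrite indicI.
  by ring.
have S i : (i < sp_size H)%N ->
    let X := sp_coef H i in
    [/\ P.-integrable setT (fun w => (D w * (X w * (W (sp_time H i.+1) w - W (sp_time H i) w)))%:E),
     (mu \x P)%E.-integrable setT (fun z => (\1_(B i) z.1 * (D z.2 * X z.2))%:E) &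
     \int[P]_w (D w * (X w * (W (sp_time H i.+1) w - W (sp_time H i) w))) =
     q * \int[(mu \x P)%E]_z (\1_(B i) z.1 * (D z.2 * X z.2))].
  move=> iH X.
  have mono := sp_mono iH.
  have [j1 j2] := drift_step q a0 aT (tin _ (ltnW iH)) mono (tle _ iH) (sp_meas iH) (HM' i iH).
  have iDX := integrable_drift_coef q a0 aT (tin _ (ltnW iH)) (sp_meas iH) (HM' i iH).
  have muB : mu (B i) = (Num.max a (sp_time H i.+1) - Num.max a (sp_time H i))%:E.
    by rewrite /B lebesgue_measure_itvoc// ge_max !le_max lexx mono orbT.
  have [k1 k2] := integral_rectangle (measurable_itv _) muB iDX.
  by split => //; rewrite k2 j2 mulrA.
split.
- under eq_fun do rewrite E1.
  by apply: (Rintegral_sum _ _).1 => i _; have [] := S i (ltn_ord i).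
- under eq_fun do rewrite E2.
  by apply: (Rintegral_sum _ _).1 => i _; have [] := S i (ltn_ord i).
- under eq_Rintegral do rewrite E1.
  under [in RHS]eq_Rintegral do rewrite E2.
  rewrite (Rintegral_sum _ _).2; last by move=> i _; have [] := S i (ltn_ord i).
  rewrite (Rintegral_sum _ _).2; last by move=> i _; have [] := S i (ltn_ord i).
  by rewrite mulr_sumr; apply: eq_bigr => i _; have [] := S i (ltn_ord i).
Qed.

(** The indicator extends [Z] by zero to an integrand on the whole product space. The map [j] is the
    identity, read as passing from the sigma-algebra of [Omega] to the smaller [F T]. *)
Lemma progressive_measurable_fun T (Z : R -> Omega -> R) : 0 <= T ->
  progressively_measurable F 0 T Z ->
  measurable_fun setT
    (fun z : measurableTypeR R * Omega => \1_(`[0, T]%classic) z.1 * Z z.1 z.2).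
Proof.
move=> T0 pZ; have := pZ T; rewrite lexx T0 => /(_ isT) mZ.
pose j (z : measurableTypeR R * Omega) : R * g_sigma_algebraType (F T) := (z.1, z.2).
have mj : measurable_fun setT j.
  apply: measurable_fun_pair; first exact: measurable_fst.
  move=> _ B mB; rewrite setTI.
  have mB' : measurable (B : set Omega) by exact: filtration_measurable mB.
  by rewrite -[X in measurable X]setTI; exact: measurable_snd.
pose E : set (measurableTypeR R * Omega) := `[0, T]%classic `*` setT.
have mE : measurable E by apply: measurableX => //; exact: measurable_itv.
have mZE : measurable_fun E (fun z => Z z.1 z.2).
  have mjE : measurable_fun E j by exact: measurable_funTS.
  apply: (measurable_comp _ _ mZ mjE); last by move=> _ [z [? _] <-]; split.
  by apply: measurableX => //; exact: measurable_itv.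
have -> : (fun z : measurableTypeR R * Omega => \1_(`[0, T]%classic) z.1 * Z z.1 z.2) =
    (fun z => Z z.1 z.2) \_ E.
  apply/funext => z; rewrite patchE indicE.
  rewrite (_ : (z \in E) = (z.1 \in `[0, T]%classic)); last first.
    by apply/idP/idP; rewrite /E !inE/= ?in_setE => // -[].
  by case: ifP => _; rewrite ?mul1r ?mul0r.
exact: (measurable_restrictT _ mE).1 mZE.
Qed.

Lemma progressive_slice T s (Z : R -> Omega -> R) : 0 <= s <= T ->
  progressively_measurable F 0 T Z -> measurable_wrt (F s) (Z s).
Proof.
move=> sT pZ; have mZ := pZ s sT; case/andP: sT => s0 _.
pose E : set (R * g_sigma_algebraType (F s)) := `[0, s]%classic `*` setT.
have mE : measurable E by apply: measurableX => //; exact: measurable_itv.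
apply: (measurable_comp mE _ mZ (pair1_measurable s)) => //.
by move=> _ [w _ <-]; split => //=; rewrite in_itv/= s0 lexx.
Qed.

(** Tonelli turns the iterated integral of the definition into the form that [cvg_Rintegral_sqr]
    takes. *)
Lemma expected_square_normE T (X : R -> Omega -> R) :
  measurable_fun setT
    (fun z : measurableTypeR R * Omega => \1_(`[0, T]%classic) z.1 * X z.1 z.2) ->
  expected_square_norm P 0 T X =
  (\int[mu \x P]_z ((\1_(`[0, T]%classic) z.1 * X z.1 z.2) ^+ 2)%:E)%E.
Proof.
move=> mX; rewrite fubini_tonelli2; last 2 first.
- by apply/measurable_EFinP; exact: measurable_funX.
- by move=> z; rewrite lee_fin sqr_ge0.
apply: eq_integral => w _; rewrite /fubini_G/= integral_mkcond.
apply: eq_integral => s _; rewrite patchE indicE.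
by case: ifP => _; rewrite ?mul1r ?mul0r ?expr0n.
Qed.

Lemma measurable_simple_eval T (H : simple_process F 0 T) :
  measurable_fun setT (fun z : measurableTypeR R * Omega => simple_eval H z.1 z.2).
Proof.
apply: measurable_sum => i; have iH := ltn_ord i.
have /andP[t0 _] := sp_time_in (ltnW iH).
apply: measurable_funM.
  apply: (measurableT_comp _ measurable_snd).
  exact: measurable_fun_filtration (sp_meas iH).
by apply: (measurableT_comp _ measurable_fst).
Qed.

Lemma measurable_simple_integral T (H : simple_process F 0 T) :
  measurable_fun setT (simple_integral W H).
Proof.
apply: measurable_sum => i; have iH := ltn_ord i.
have /andP[t0 _] := sp_time_in (ltnW iH).
have /andP[t1 _] := sp_time_in iH.
apply: measurable_funM; first exact: measurable_fun_filtration (sp_meas iH).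
by apply: measurable_funB; exact: (bm_measurable W_bm).
Qed.

(* Girsanov's formula, with [W] acquiring the drift [q] on [[a, T]]. *)
Lemma ito_drift q a T (Z : R -> Omega -> R) (I : Omega -> R) :
  0 <= a -> a <= T -> is_ito_integral P F W 0 T Z I ->
  let D := drift_density q a T in
  let Zb z := \1_(`[0, T]%classic) z.1 * Z z.1 z.2 in
  [/\ P.-integrable setT (fun w => (D w * I w)%:E),
    (mu \x P)%E.-integrable setT
      (fun z => (\1_(`]a, T]%classic) z.1 * D z.2 * Zb z)%:E) &
    \int[P]_w (D w * I w) =
    q * \int[(mu \x P)%E]_z (\1_(`]a, T]%classic) z.1 * D z.2 * Zb z)].
Proof.
move=> a0 aT [pZ Zfin mI [H [HZ HI]]] D Zb.
have T0 := le_trans a0 aT.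
have mD : measurable_fun setT D by exact: measurable_drift_density.
have mZb : measurable_fun setT Zb by exact: progressive_measurable_fun.
have m1 : measurable_fun setT
   (fun z : measurableTypeR R * Omega => \1_(`]a, T]%classic) z.1 : R).
  by apply: (measurableT_comp _ measurable_fst).
have m2 : measurable_fun setT
   (fun z : measurableTypeR R * Omega => \1_(`[0, T]%classic) z.1 : R).
  by apply: (measurableT_comp _ measurable_fst).
pose k (z : measurableTypeR R * Omega) := \1_(`]a, T]%classic) z.1 * D z.2.
have mk : measurable_fun setT k.
  by apply: measurable_funM => //; apply: (measurableT_comp _ measurable_snd).
pose h n (z : measurableTypeR R * Omega) :=
  \1_(`[0, T]%classic) z.1 * simple_eval (H n) z.1 z.2.
have mh n : measurable_fun setT (h n).
  by apply: measurable_funM => //; exact: measurable_simple_eval.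
have khE n z : k z * h n z = \1_(`]a, T]%classic) z.1 * D z.2 * simple_eval (H n) z.1 z.2.
  rewrite /k /h mulrA; congr (_ * _).
  rewrite !indicE; case: (boolP (z.1 \in _)) => za; last by rewrite !mul0r.
  rewrite (_ : z.1 \in `[0, T]%classic) ?mulr1//.
  move: za; rewrite !inE/= !in_itv/= => /andP[az zT].
  by rewrite zT (le_trans a0 (ltW az)).
have muaT := lebesgue_measure_itvoc aT.
have ik2 : (mu \x P)%E.-integrable setT (fun z => (k z ^+ 2)%:E).
  have [+ _] := integral_rectangle (measurable_itv _) muaT
    (integrable_drift_density_sq q a0 aT).
  apply: eq_integrable => // z _; congr EFin.
  by rewrite /k exprMn indicE; case: (_ \in _); rewrite ?expr1n ?expr0n ?mul0r.
(* Pairing with the fixed square integrable [D], and below with [k], is continuous for [L^2]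
   convergence, so both sides of [drift_simple] pass to the limit. *)
have [i1 c1] : P.-integrable setT (fun w => (D w * I w)%:E) /\
  (fun n => \int[P]_w (D w * simple_integral W (H n) w)) @ \oo -->
  \int[P]_w (D w * I w).
  apply: cvg_Rintegral_sqr => //.
  - by move=> n; exact: measurable_simple_integral.
  - exact: integrable_drift_density_sq.
  - by move=> n; have [] := drift_simple q (H n) a0 aT.
have [i2 c2] : (mu \x P)%E.-integrable setT (fun z => (k z * Zb z)%:E) /\
  (fun n => \int[(mu \x P)%E]_z (k z * h n z)) @ \oo -->
  \int[(mu \x P)%E]_z (k z * Zb z).
  apply: cvg_Rintegral_sqr => //.
  - move=> n; have [_ + _] := drift_simple q (H n) a0 aT.
    by apply: eq_integrable => // z _; rewrite khE.
  - rewrite [X in X @ _ --> _](_ : _ = (fun n => expected_square_norm P 0 T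
      (fun s w => simple_eval (H n) s w - Z s w)))//.
    have E n z : \1_(`[0, T]%classic) z.1 * (simple_eval (H n) z.1 z.2 - Z z.1 z.2)
       = h n z - Zb z by rewrite mulrBr.
    apply/funext => n; rewrite expected_square_normE.
      by apply: eq_integral => z _; rewrite E.
    under eq_fun do rewrite E.
    exact: measurable_funB.
have c3 : (fun n => q * \int[(mu \x P)%E]_z (k z * h n z)) @ \oo -->
  q * \int[(mu \x P)%E]_z (k z * Zb z) by apply: cvgM c2; exact: cvg_cst.
split => //; apply: cvg_unique c1 _ => //.
rewrite (_ : (fun n => _) = (fun n => q * \int[(mu \x P)%E]_z (k z * h n z)))//.
apply/funext => n; have [_ _ ->] := drift_simple q (H n) a0 aT.
by congr (_ * _); apply: eq_Rintegral => z _; rewrite khE.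
Qed.

(** * The equation at time 0, seen under the drift *)

Section Equation.
Variables (T : R) (f : R -> R) (Z : R -> Omega -> R) (Y xi I : Omega -> R) (K L : R).
Hypotheses (T0 : 0 <= T) (mf : measurable_fun setT f) (f0 : forall x, 0 <= f x)
  (f00 : f 0 = 0) (ZI : is_ito_integral P F W 0 T Z I)
  (fZ_fin : (\int[P]_w \int[mu]_(s in `[0%R, T]) (f (Z s w))%:E < +oo)%E)
  (mY : measurable_wrt (F 0) Y) (YK : {ae P, forall w, `|Y w| <= K})
  (mxi : measurable_fun setT xi) (xiL : forall w, `|xi w| <= L)
  (YE : {ae P, forall w,
     Y w = xi w + \int[mu]_(s in `[0, T]) f (Z s w) - I w}).

Local Notation Zb := (fun z : measurableTypeR R * Omega =>
  \1_(`[0, T]%classic) z.1 * Z z.1 z.2).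
Local Notation fZ := (fun z : measurableTypeR R * Omega => f (Zb z)).

Let pZ : progressively_measurable F 0 T Z. Proof. by case: ZI. Qed.

Lemma measurable_running_cost : measurable_fun setT fZ.
Proof. by apply: (measurableT_comp mf); exact: progressive_measurable_fun. Qed.
Let mfZ := measurable_running_cost.

(** Since [f 0 = 0], the extension of [Z] by zero costs nothing outside [[0, T]]. *)
Lemma fubini_running_cost w :
  (\int[mu]_s (fZ (s, w))%:E = \int[mu]_(s in `[0%R, T]) (f (Z s w))%:E)%E.
Proof.
rewrite [RHS]integral_mkcond; apply: eq_integral => s _.
by rewrite patchE indicE /=; case: ifP => _; rewrite ?mul1r ?mul0r ?f00.
Qed.

Let Gamma (w : Omega) : \bar R := (\int[mu]_s (fZ (s, w))%:E)%E.

Let mGamma : measurable_fun setT Gamma.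
Proof.
apply: (@measurable_fun_fubini_tonelli_G _ _ _ _ _ mu (EFin \o fZ)).
- exact/measurable_EFinP.
- by move=> z; rewrite lee_fin.
Qed.

Let Gamma0 w : (0 <= Gamma w)%E.
Proof. by apply: integral_ge0 => s _; rewrite lee_fin. Qed.

(** Where the extended integral is infinite, the real one takes a default value; the finite expected
    cost excludes this almost surely. *)
Let GammaE : {ae P, forall w, Gamma w = (\int[mu]_(s in `[0, T]) f (Z s w))%:E}.
Proof.
have iG : P.-integrable setT Gamma.
  apply/integrableP; split => //.
  under eq_integral do rewrite gee0_abs// /Gamma fubini_running_cost.
  exact: fZ_fin.
apply: filterS (integrable_ae measurableT iG) => w /(_ Logic.I) fin.
by rewrite /Rintegral -fubini_running_cost fineK.
Qed.

Let mY' : measurable_fun setT Y.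
Proof. exact: measurable_fun_filtration mY. Qed.

Let iY : P.-integrable setT (EFin \o Y).
Proof.
apply/integrableP; split; first exact/measurable_EFinP.
apply: (@le_lt_trans _ _ (\int[P]_w (`|K|)%:E)%E).
  apply: ae_ge0_le_integral => //.
  - by apply/measurable_EFinP; exact: measurableT_comp.
  - by apply: filterS YK => w Yw _; rewrite /= lee_fin (le_trans Yw) ?ler_norm.
by rewrite integral_cst//= probability_setT mule1 ltry.
Qed.

(** Multiply the equation by [D] and take expectations; [Y], known at time 0, keeps its mean. The
    running cost is integrable against [D] because the equation expresses it through terms that
    are. *)
Lemma drift_equation q a : 0 <= a -> a <= T ->
  let D := drift_density q a T in
  [/\ P.-integrable setT (fun w => (D w * xi w)%:E),
    (mu \x P)%E.-integrable setT (fun z => (D z.2 * fZ z)%:E) &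
    \int[(mu \x P)%E]_z (D z.2 * fZ z) = \int[P]_w Y w
      + q * \int[(mu \x P)%E]_z (\1_(`]a, T]%classic) z.1 * D z.2 * Zb z)
      - \int[P]_w (D w * xi w)].
Proof.
move=> a0 aT D; have mD : measurable_fun setT D by exact: measurable_drift_density.
have D0 w : 0 <= D w by exact/ltW/drift_density_gt0.
have iD := integrable_drift_density q a0 aT.
have [iDI _ DIE] := ito_drift q a0 aT ZI.
have mYa : measurable_wrt (F a) Y by exact: measurable_wrt_filtration mY.
have iDY : P.-integrable setT (fun w => (D w * Y w)%:E).
  by under eq_fun do rewrite mulrC; exact: integrable_mul_drift_density.
have DYE : \int[P]_w (D w * Y w) = \int[P]_w Y w.
  by under eq_Rintegral do rewrite mulrC; exact: Rintegral_mul_drift_density.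
have iDxi : P.-integrable setT (fun w => (D w * xi w)%:E).
  apply: le_integrable (integrableZl measurableT L iD) => //.
    by apply/measurable_EFinP; exact: measurable_funM.
  move=> w _ /=; rewrite lee_fin !normrM mulrC ler_wpM2r//.
  by rewrite (le_trans (xiL w)) ?ler_norm.
have mDfZ : measurable_fun setT (fun z : measurableTypeR R * Omega => D z.2 * fZ z).
  by apply: measurable_funM => //; apply: (measurableT_comp _ measurable_snd).
pose S w := D w * Y w + D w * I w - D w * xi w.
have iDYI := integrableD measurableT iDY iDI.
have iS : P.-integrable setT (fun w => (S w)%:E) := integrableB measurableT iDYI iDxi.
have SE : (\int[mu \x P]_z (D z.2 * fZ z)%:E = \int[P]_w (S w)%:E)%E.
  rewrite fubini_tonelli2; last 2 first.
  - exact/measurable_EFinP.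
  - by move=> z; rewrite lee_fin mulr_ge0.
  transitivity (\int[P]_w ((D w)%:E * Gamma w))%E.
    apply: eq_integral => w _; rewrite /fubini_G/= -ge0_integralZl//.
    - apply/measurable_EFinP; exact: (measurable_fun_pair1 w mfZ).
    - by move=> s _; rewrite lee_fin.
    - by rewrite lee_fin.
  apply: ae_eq_integral => //.
  - by apply: emeasurable_funM => //; exact/measurable_EFinP.
  - exact: measurable_int iS.
  apply: filterS2 GammaE YE => w Gw Yw _.
  by rewrite Gw -EFinM; congr EFin; rewrite /S Yw; ring.
split => //.
  apply/integrableP; split; first exact/measurable_EFinP.
  under eq_integral do rewrite /= ger0_norm ?mulr_ge0//.
  by rewrite SE; exact: integrable_lty.
rewrite /Rintegral SE -/(Rintegral P setT S) /S RintegralB//.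
by rewrite RintegralD// DYE DIE.
Qed.

(** At a time [s <= a] the cost is known at [a], where the drift has not started; Tonelli applies
    this slice by slice. *)
Lemma tonelli_before q a : 0 <= a -> a <= T ->
  (\int[mu \x P]_z (\1_(`[0, a]%classic) z.1 * (drift_density q a T z.2 * fZ z))%:E =
   \int[mu \x P]_z (\1_(`[0, a]%classic) z.1 * fZ z)%:E)%E.
Proof.
move=> a0 aT; have mD : measurable_fun setT (drift_density q a T).
  exact: measurable_drift_density.
have D0 w : 0 <= drift_density q a T w by exact/ltW/drift_density_gt0.
have mind : measurable_fun setT
   (fun z : measurableTypeR R * Omega => \1_(`[0, a]%classic) z.1 : R).
  by apply: (measurableT_comp _ measurable_fst).
rewrite !fubini_tonelli1; last 4 first.
- by apply/measurable_EFinP; exact: measurable_funM.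
- by move=> z; rewrite lee_fin mulr_ge0.
- apply/measurable_EFinP; apply: measurable_funM => //; apply: measurable_funM => //.
  by apply: (measurableT_comp _ measurable_snd).
- by move=> z; rewrite lee_fin !mulr_ge0.
apply: eq_integral => s _; rewrite /fubini_F/= !indicE.
have [sa|_] := boolP (s \in _); last first.
  by under eq_integral do rewrite mul0r; under [RHS]eq_integral do rewrite mul0r.
have {}sa : 0 <= s <= a by move: sa; rewrite inE/= in_itv.
have sT : 0 <= s <= T by case/andP: sa => -> /le_trans ->.
have -> : s \in `[0, T]%classic by rewrite inE/= in_itv.
under eq_integral do rewrite !mul1r mulrC.
under [RHS]eq_integral do rewrite !mul1r.
apply: ge0_integral_mul_drift_density => //.
apply: (measurable_wrt_comp mf); apply: measurable_wrt_filtration (progressive_slice sT pZ).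
by case/andP: sa.
Qed.

(** Compare [drift_equation] at [q] and at [0], where the density is one. The costs on [[0, a]]
    cancel, and on []a, T]] the bound by [kappa] is integrated against [D], whose total mass there
    is [T - a]. *)
Lemma drift_inequality q a (kappa : R) : 0 <= a -> a <= T ->
  (forall z, q * z - f z <= kappa) ->
  \int[P]_w (drift_density q a T w * xi w) - \int[P]_w xi w <=
  \int[(mu \x P)%E]_z (\1_(`]a, T]%classic) z.1 * fZ z) + kappa * (T - a).
Proof.
move=> a0 aT kappaP; set D := drift_density q a T.
have mD : measurable_fun setT D by exact: measurable_drift_density.
have D0 w : 0 <= D w by exact/ltW/drift_density_gt0.
have [_ iDf DfE] := drift_equation q a0 aT.
have [_ if_ fE] := drift_equation 0 a0 aT.
have [_ iDZ _] := ito_drift q a0 aT ZI.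
rewrite -/D in iDf DfE iDZ.
have {}if_ : (mu \x P)%E.-integrable setT (EFin \o fZ).
  by apply: eq_integrable if_ => // z _; rewrite /= drift_density0 mul1r.
have {}fE : \int[(mu \x P)%E]_z fZ z = \int[P]_w Y w - \int[P]_w xi w.
  rewrite mul0r addr0 in fE.
  rewrite (_ : \int[P]_w xi w = \int[P]_w (drift_density 0 a T w * xi w)); last first.
    by apply: eq_Rintegral => w _; rewrite drift_density0 mul1r.
  by rewrite -fE; apply: eq_Rintegral => z _; rewrite drift_density0 mul1r.
have mS (B : set R) : measurable B -> measurable_fun setT
   (fun z : measurableTypeR R * Omega => \1_B z.1 : R).
  by move=> mB; apply: (measurableT_comp _ measurable_fst).
have restr (B : set R) (h : measurableTypeR R * Omega -> R) : measurable B ->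
    (mu \x P)%E.-integrable setT (EFin \o h) ->
    (mu \x P)%E.-integrable setT (fun z => (\1_B z.1 * h z)%:E).
  move=> mB ih; apply: le_integrable (ih) => //.
    apply/measurable_EFinP; apply: measurable_funM; first exact: mS.
    by apply/measurable_EFinP; exact: measurable_int ih.
  by move=> z _ /=; rewrite lee_fin normrM ler_piMl// ger0_norm// indicE.
have splitE z : fZ z = \1_(`[0, a]%classic) z.1 * fZ z + \1_(`]a, T]%classic) z.1 * fZ z.
  rewrite !indicE !mem_setE !in_itv/=.
  case: (boolP (0 <= z.1 <= T)); last first.
    move=> h; rewrite mul0r f00 !mulr0 addr0//.
  move=> /andP[z0 zT]; rewrite z0 zT andbT/= ltNge.
  by case: (z.1 <= a); rewrite ?mul1r ?mul0r ?addr0 ?add0r.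
have m0a := measurable_itv `[0, a]; have maT := measurable_itv `]a, T].
have i1 := restr _ _ m0a if_; have i2 := restr _ _ maT if_.
have i3 := restr _ _ m0a iDf; have i4 := restr _ _ maT iDf.
have E1 : \int[(mu \x P)%E]_z fZ z =
    \int[(mu \x P)%E]_z (\1_(`[0, a]%classic) z.1 * fZ z) +
    \int[(mu \x P)%E]_z (\1_(`]a, T]%classic) z.1 * fZ z).
  by rewrite -RintegralD//; apply: eq_Rintegral => z _; exact: splitE.
have E2 : \int[(mu \x P)%E]_z (D z.2 * fZ z) =
    \int[(mu \x P)%E]_z (\1_(`[0, a]%classic) z.1 * (D z.2 * fZ z)) +
    \int[(mu \x P)%E]_z (\1_(`]a, T]%classic) z.1 * (D z.2 * fZ z)).
  rewrite -RintegralD//; apply: eq_Rintegral => z _.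
  by rewrite {1}splitE; ring.
have E3 : \int[(mu \x P)%E]_z (\1_(`[0, a]%classic) z.1 * (D z.2 * fZ z)) =
    \int[(mu \x P)%E]_z (\1_(`[0, a]%classic) z.1 * fZ z).
  by rewrite /Rintegral tonelli_before.
have muaT := lebesgue_measure_itvoc aT.
have [i5 E5] := integral_rectangle maT muaT (integrable_drift_density q a0 aT).
rewrite -/D Rintegral_drift_density// mulr1 in i5 E5.
have i6 := integrableZl measurableT q iDZ.
have i7 := integrableZl measurableT kappa i5.
have le : q * \int[(mu \x P)%E]_z (\1_(`]a, T]%classic) z.1 * D z.2 * Zb z) -
    \int[(mu \x P)%E]_z (\1_(`]a, T]%classic) z.1 * (D z.2 * fZ z)) <= kappa * (T - a).
  rewrite -E5 -!RintegralZl// -RintegralB//.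
  apply: le_Rintegral => //; first exact: (integrableB measurableT i6 i4).
  move=> z _; have := kappaP (Zb z); set x := Zb z => xk.
  have -> : q * (\1_(`]a, T]%classic) z.1 * D z.2 * x) -
    \1_(`]a, T]%classic) z.1 * (D z.2 * f x) =
    (\1_(`]a, T]%classic) z.1 * D z.2) * (q * x - f x) by ring.
  by rewrite [leRHS]mulrC ler_wpM2l// mulr_ge0.
move: le E1 E2 E3 fE DfE; lra.
Qed.

Lemma tail_running_cost (t_ : nat -> R) : t_ @ \oo --> T ->
  (fun n => \int[(mu \x P)%E]_z (\1_(`]t_ n, T]%classic) z.1 * fZ z)) @ \oo --> (0 : R).
Proof.
move=> tT; have [_ ifZ _] := drift_equation 0 T0 (lexx T).
have {}ifZ : (mu \x P)%E.-integrable setT (EFin \o fZ).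
  by apply: eq_integrable ifZ => // z _; rewrite /= drift_density0 mul1r.
have [|||||_ _ +] := @dominated_convergence _ _ R (mu \x P)%E setT measurableT
  (fun n z => (\1_(`]t_ n, T]%classic) z.1 * fZ z)%:E) (cst 0%E) (EFin \o fZ).
- move=> n; apply/measurable_EFinP; apply: measurable_funM => //.
  by apply: (measurableT_comp _ measurable_fst).
- exact: measurable_cst.
(* At time [T] itself the indicators need not tend to zero, but this slice is null. *)
- exists ([set T] `*` setT); split.
  + exact: measurableX.
  + transitivity (mu [set T] * P setT)%E; first exact: product_measure1E.
    by rewrite lebesgue_measure_set1 mul0e.
  move=> z /= nz; split => //=; apply: contrapT => zT; apply: nz => _.
  apply: cvg_near_cst; rewrite /cst/=.
  have [Tz|zT'] := ltP T z.1.
    near=> n; rewrite indicE mem_setE in_itv/= [_ <= T]leNgt Tz andbF.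
    by rewrite mul0r.
  have {zT'}zT : z.1 < T by rewrite lt_neqAle zT' andbT; apply/eqP.
  near=> n; rewrite indicE mem_setE in_itv/= ltNge (_ : z.1 <= t_ n) ?mul0r//.
  by near: n; exact: (cvgr_ge T tT _ zT).
- exact: ifZ.
- apply: aeW => z n _; rewrite /= lee_fin normrM ger0_norm// ger0_norm//.
  by rewrite ler_piMl// indicE; case: (_ \in _).
by rewrite integral0 => /fine_cvg.
Unshelve. all: by end_near.
Qed.

End Equation.

(** * An event that is rare without the drift and likely with it *)

Section Event.
Variables (q s t b : R).
Hypotheses (s0 : 0 <= s) (st : s < t) (qb : q ^+ 2 * (t - s) = 4 * b).

(** As [q ^+ 2 * (t - s) = 4 * b], the variable [q * (W t w - W s w)] has variance [4 * b] and mean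
    [0], or mean [4 * b] under the drift; for large [b] the threshold [b] separates the two laws. *)
Definition large_increment : set Omega := [set w | b < q * (W t w - W s w)].

Lemma filtration_large_increment : <<s F t>> large_increment.
Proof.
have t0 := le_trans s0 (ltW st).
have mV : measurable_wrt (F t) (fun w => q * (W t w - W s w)).
  apply: (measurable_wrt_comp (f := fun x => q * x)); first exact: measurable_funM.
  by apply: measurable_wrtB; apply: measurable_wrt_bm => //; exact: ltW.
have := mV measurableT `]b, +oo[%classic (measurable_itv _); rewrite setTI.
suff -> : large_increment = (fun w => q * (W t w - W s w)) @^-1` `]b, +oo[%classic by [].
by apply/seteqP; split => w; rewrite /large_increment/= in_itv/= andbT.
Qed.

Lemma measurable_large_increment : measurable large_increment.
Proof.
exact: (filtration_measurable (le_trans s0 (ltW st)) filtration_large_increment).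
Qed.

(* Chernoff's bound with exponent [q / 4]. *)
Lemma probability_large_increment : (P large_increment <= (expR (- b / 8))%:E)%E.
Proof.
have mA := measurable_large_increment.
have iE := integrable_expR_increment s0 st (q / 4).
have iE' := integrableZl measurableT (expR (- b / 4)) iE.
rewrite -[X in P X]setIT -integral_indic//.
have -> : expR (- b / 8) =
    \int[P]_w (expR (- b / 4) * expR (q / 4 * (W t w - W s w))).
  rewrite RintegralZl// Rintegral_expR_increment// -expRD; congr expR.
  (* The exponents add up to [- b / 4 + 4 * b / 32 = - b / 8]. *)
  have -> : (q / 4) ^+ 2 * (t - s) = q ^+ 2 * (t - s) / 16 by field.
  by rewrite qb; field.
rewrite /Rintegral fineK; last exact: (integrable_fin_num measurableT iE').
apply: ge0_le_integral => //.
- exact/measurable_EFinP/measurable_indic.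
- exact: measurable_int iE'.
move=> w _; rewrite lee_fin -expRD indicE.
have [|_] := boolP (w \in _); last exact: expR_ge0.
rewrite inE /large_increment/= => bw; rewrite -[leLHS]expR0 ler_expR.
rewrite (_ : _ + _ = (q * (W t w - W s w) - b) / 4); last by field.
by rewrite divr_ge0// subr_ge0 ltW.
Qed.

(** Off the event the density is at most [expR (b - 2 * b)], so the complement has mass at most
    [expR (- b)] under the drift. The superset [A] allows for the union of all the events. *)
Lemma drift_large_increment (A : set Omega) : measurable A -> large_increment `<=` A ->
  1 - expR (- b) <= \int[P]_w (drift_density q s t w * \1_A w).
Proof.
move=> mA subA; have iD := integrable_drift_density q s0 (ltW st).
have iDA : P.-integrable setT (fun w => (drift_density q s t w * \1_A w)%:E).
  apply: le_integrable (iD) => //.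
    apply/measurable_EFinP; apply: measurable_funM => //.
    exact: measurable_drift_density (ltW st).
  move=> w _ /=; rewrite lee_fin normrM ler_piMr// indicE.
  by case: (w \in A); rewrite ?normr1 ?normr0.
have ic := finite_measure_integrable_cst P (expR (- b)) measurableT.
have cE : \int[P]_(_ in setT) expR (- b) = expR (- b).
  by rewrite Rintegral_cst//= probability_setT mulr1.
rewrite lerBlDr -(Rintegral_drift_density q s0 (ltW st)) -[X in _ + X]cE -RintegralD//.
apply: le_Rintegral => //; first exact: (integrableD measurableT iDA ic).
move=> w _; rewrite indicE; have [_|wA] := boolP (w \in A).
  by rewrite mulr1 lerDl expR_ge0.
rewrite mulr0 add0r /drift_density ler_expR qb.
have : ~ large_increment w.
  by move=> /subA Aw; move/negP: wA; apply; rewrite inE.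
by rewrite /large_increment/= => /negP; rewrite -leNgt; lra.
Qed.

End Event.

End Brownian.

(** * Choice of the data and the contradiction *)

Theorem theorem5p4 (R : realType) (d : measure_display)
    (Omega : measurableType d) (P : probability Omega R)
    (P_complete : measure_is_complete P)
    (W : R -> Omega -> R)
    (W_bm : brownian_motion P (augmented_natural_filtration P W) W)
    (T : R) (T_gt0 : 0 < T)
    (g : R -> R -> R)
    (g_ge0 : forall t z : R, 0 <= t <= T -> 0 <= g t z)
    (g_convex : forall t : R, 0 <= t <= T ->
       @convex_function R R^o setT (g t))
    (g_0 : forall t : R, 0 <= t <= T -> g t 0 = 0)
    (g_superquadratic : forall t : R, 0 <= t <= T ->
       limf_esup (fun z : R => (g t z / `|z| ^+ 2)%:E) (norm_infty_nbhs R)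
         = +oo%E) :
  exists psi : R -> Omega -> R,
    [/\ exists M : R, forall (t : R) w, 0 <= t <= T -> `|psi t w| <= M,
        jointly_measurable_wrt (augmented_natural_filtration P W T) 0 T psi &
        ~ exists Y Z, bounded_solution P W T g psi Y Z].
Proof.
(* [b n = 8 * 2^(n+2)] makes Chernoff's bounds [expR (- b n / 8)] sum to at most
   1/2, and [K = 4 (b n) (n + 1)] makes the cost of the drift 1 / (n + 1). *)
have T0 : (0 : R) <= 0 <= T by apply/andP; split => //; exact: ltW.
(* [p = (q, kappa, h)]: the drift, the bound on [q * z - g 0 z], and the length of the interval
   before [T] on which the drift acts. *)
have sel n : exists p : R * R * R,
    [/\ 0 < p.2, p.2 <= T, p.2 <= n.+1%:R^-1,
      forall z, p.1.1 * z - g 0 z <= p.1.2 &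
      p.1.2 * p.2 = n.+1%:R^-1 /\ p.1.1 ^+ 2 * p.2 = 4 * (8 * 2 ^+ n.+2)].
  have b0 : 0 < 8 * 2 ^+ n.+2 :> R by rewrite mulr_gt0// exprn_gt0.
  have n0 : 0 < n.+1%:R :> R by rewrite ltr0n.
  have K0 : 0 < 4 * (8 * 2 ^+ n.+2) * n.+1%:R :> R by rewrite mulr_gt0// mulr_gt0.
  have eta0 : 0 < Num.min T n.+1%:R^-1 by rewrite lt_min T_gt0 invr_gt0.
  have [q [kappa [h [h0 heta le kh qh]]]] := superquadratic_drift
    (fun z => g_ge0 0 z T0) (g_0 0 T0) (g_convex 0 T0) (g_superquadratic 0 T0) b0 K0 eta0.
  exists (q, kappa, h); move: heta; rewrite le_min => /andP[hT hn]; split => //=.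
  split => //; rewrite kh; move: (4 * _) (mulr_gt0 (ltr0n R 4) b0) => x x0.
  by field; rewrite !gt_eqF.
have [p pP] := choice sel.
pose b n : R := 8 * 2 ^+ n.+2.
pose t n := T - (p n).2.
have t0 n : 0 <= t n by rewrite subr_ge0; have [] := pP n.
have tT n : t n < T by rewrite ltrBlDr ltrDl; have [] := pP n.
have tE n : T - t n = (p n).2 by rewrite /t opprB addrC subrK.
have qb n : (p n).1.1 ^+ 2 * (T - t n) = 4 * b n.
  by rewrite tE; have [_ _ _ _ []] := pP n.
pose A n := large_increment W (p n).1.1 (t n) T (b n).
pose AA := \bigcup_n A n.
have mA n : measurable (A n)
  by exact: (measurable_large_increment P_complete W_bm _ _ (t0 n) (tT n)).
have mAA : measurable AA by exact: bigcup_measurable.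
(* This is [x <= expR x] at [x = 2 ^+ n.+2], written as the summand of [epsilon_trick0]. *)
have b_small n : expR (- b n / 8) <= 2^-1 / (2 ^ n.+1)%:R.
  rewrite /b (_ : - _ / 8 = - 2 ^+ n.+2); last by field.
  rewrite natrX -invfM -exprS expRN lef_pV2 ?posrE ?expR_gt0 ?exprn_gt0//.
  by apply: le_trans (expR_ge1Dx _); rewrite lerDr.
have PAA : (P AA <= (2^-1)%:E)%E.
  apply: le_trans (measure_sigma_subadditive P mA mAA _) _ => //.
  apply: le_trans (@epsilon_trick0 R 2^-1 xpredT _); last by rewrite invr_ge0.
  apply: lee_nneseries => // n _.
  apply: le_trans (probability_large_increment P_complete W_bm (t0 n) (tT n) (qb n)) _.
  by rewrite lee_fin b_small.
have FAA : <<s augmented_natural_filtration P W T>> AA.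
  apply: sigma_algebra_bigcup => n.
  exact: (filtration_large_increment W_bm _ _ (t0 n) (tT n)).
(* The datum is constant in time, so its joint measurability reduces to [FAA]. *)
exists (fun _ w => \1_AA w); split.
- by exists 1 => s w _; rewrite indicE; case: (w \in AA); rewrite ?normr1 ?normr0.
- apply: measurable_funTS; apply: (measurableT_comp _ measurable_snd).
  exact: measurable_indic.
move=> [Y [Z [adY pZ [K YK] g_fin YE]]].
have [I ZI YE0] := YE 0 T0.
have mg := convex_measurable_fun (g_convex _ T0).
have mY : measurable_wrt (augmented_natural_filtration P W 0) (Y 0) by exact: adY.
have mxi : measurable_fun setT (\1_AA : Omega -> R) by exact: measurable_indic.
have xi1 (w : Omega) : `|\1_AA w : R| <= 1.
  by rewrite indicE; case: (w \in AA); rewrite ?normr1 ?normr0.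
have g_ge z : 0 <= g 0 z by exact: g_ge0.
have t_cvg : t @ \oo --> T.
  rewrite -[X in _ --> X]subr0; apply: cvgB; first exact: cvg_cst.
  apply: (squeeze_cvgr _ (cvg_cst 0) cvg_harmonic); apply: nearW => n.
  by have [h0 _ hn _ _] := pP n; rewrite ltW.
have tail := tail_running_cost P_complete W_bm (ltW T_gt0) mg g_ge (g_0 _ T0)
  ZI (g_fin 0 T0) mY (YK 0 T0) mxi xi1 YE0 t_cvg.
set a_ := (X in X @ \oo --> _) in tail.
have PA2 : \int[P]_w \1_AA w <= 2^-1 :> R.
  rewrite /Rintegral integral_indic// setIT -lee_fin fineK//.
  by rewrite fin_num_measure.
(* The [n]-th drift gives [AA] mass at least [3 / 4], while its probability is at most [1 / 2]. *)
have lower n : 4^-1 <= a_ n + n.+1%:R^-1.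
  have [_ _ _ kappaP [kappaE _]] := pP n.
  have subA : A n `<=` AA by exact: bigcup_sup.
  have := drift_large_increment P_complete W_bm (t0 n) (tT n) (qb n) mAA subA.
  have := drift_inequality P_complete W_bm (ltW T_gt0) mg g_ge (g_0 _ T0)
    ZI (g_fin 0 T0) mY (YK 0 T0) mxi xi1 YE0 (t0 n) (ltW (tT n)) kappaP.
  rewrite tE kappaE -/(a_ n).
  have : expR (- b n) <= 4^-1.
    have b4 : 4 <= 1 + b n.
      rewrite /b (_ : 2 ^+ n.+2 = 4 * 2 ^+ n :> R); last by rewrite !exprS; ring.
      have : 1 <= 2 ^+ n :> R by rewrite exprn_ege1// ler1n.
      lra.
    rewrite expRN lef_pV2 ?posrE ?expR_gt0//.
    exact: le_trans b4 (expR_ge1Dx _).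
  move=> e4 ineq large; apply: le_trans ineq.
  rewrite lerBrDr (le_trans (lerD (lexx _) PA2))//.
  by apply: le_trans large; move: e4; lra.
have lim0 : (fun n => a_ n + n.+1%:R^-1) @ \oo --> (0 : R).
  by rewrite -[X in _ --> X]addr0; apply: cvgD => //; exact: cvg_harmonic.
have : 4^-1 <= 0 :> R.
  by apply: (cvgr_to_ge lim0); exact: nearW.
by rewrite leNgt invr_gt0 ltr0n.
Qed.
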